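(* Let $1\le p<\infty$ and let $\Lambda=\{\lambda_n:n\in\mathbf{N}\}$ and $\Upsilon=\{\upsilon_n:n\in\mathbf{N}\}$ be increasing sequences of positive numbers, each satisfying the gap condition ($\inf_n(\lambda_{n+1}-\lambda_n)>0$ and $\inf_n(\upsilon_{n+1}-\upsilon_n)>0$) and the Müntz condition ($\sum_{n=1}^\infty\lambda_n^{-1}<\infty$ and $\sum_{n=1}^\infty\upsilon_n^{-1}<\infty$). Suppose $\lambda_n\le\upsilon_n$ for each $n$. If $\sup_n(\upsilon_n-\lambda_n)=\delta$, where $\delta<\left(8\sum_{n=1}^\infty\lambda_n^{-1}\right)^{-1}$, then $M_{\Lambda,p}$ and $M_{\Upsilon,p}$ are isomorphic Banach spaces.
   Context: $\mathbf{F}$ is $\mathbf{R}$ or $\mathbf{C}$. The Müntz space $M_{\Lambda,p}=M_{\Lambda,p}([0,1],\mathbf{F})$ is the completion, relative to the $L_p([0,1],\mathbf{F})$ norm, of the $\mathbf{F}$-linear span of the monomials $t^\lambda$, $\lambda\in\Lambda$, $t\in[0,1]$; similarly for $M_{\Upsilon,p}$. Isomorphic means linearly homeomorphic. *)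

(* Defs.v *)
From HB Require Import structures.
From mathcomp Require Import all_boot all_order all_algebra.
From mathcomp Require Import generic_quotient ring_quotient.
From mathcomp Require Import all_classical all_reals all_analysis.
From mathcomp Require Import measurable_realfun.
From mathcomp Require Import complex lra.

Set Implicit Arguments.
Unset Strict Implicit.
Unset Printing Implicit Defensive.

Import Order.TTheory GRing.Theory Num.Theory.
Import numFieldNormedType.Exports.

Local Open Scope classical_set_scope.
Local Open Scope ring_scope.

Variant scalar_field := RealScalars | ComplexScalars.

Definition scalars (R : realType) (F : scalar_field) : numFieldType :=
  match F with
  | RealScalars => R
  | ComplexScalars => R[i]
  end.

Definition of_real (R : realType) (F : scalar_field) : R -> scalars R F :=
  match F with
  | RealScalars => fun x => x
  | ComplexScalars => fun x => real_complex R x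
  end.
Arguments of_real {R F} x.

(* The norm of a numFieldType takes values in the field itself; [scalar_abs]
   is the same absolute value, seen in [R] (see [scalar_absE]). *)
Definition scalar_abs (R : realType) (F : scalar_field) : scalars R F -> R :=
  match F with
  | RealScalars => fun z => `|z|
  | ComplexScalars => fun z => complex.Re `|z|
  end.
Arguments scalar_abs {R F} z.

Section scalars_theory.
Context {R : realType} {F : scalar_field}.
Local Notation K := (scalars R F).
Implicit Types (x y : R) (z : K).

Lemma scalar_absE z : of_real (scalar_abs z) = `|z|.
Proof.
case: F z => z /=; first by [].
by case: z => a b; rewrite /Num.norm /=.
Qed.

Lemma of_real0 : of_real 0 = 0 :> K. Proof. by case: F => /=. Qed.

Lemma of_realD x y : of_real (x + y) = of_real x + of_real y :> K.
Proof. by case: F => //=; rewrite rmorphD. Qed.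

Lemma of_realM x y : of_real (x * y) = of_real x * of_real y :> K.
Proof. by case: F => //=; rewrite rmorphM. Qed.

Lemma le_of_real x y : (of_real x <= of_real y :> K) = (x <= y).
Proof. by case: F => //=; rewrite lecR. Qed.

Lemma lt_of_real x y : (of_real x < of_real y :> K) = (x < y).
Proof. by case: F => //=; rewrite ltcR. Qed.

Lemma of_real_inj : injective (of_real : R -> K).
Proof. by case: F => //= x y /complexI. Qed.

Lemma of_real_pos z : 0 < z -> exists2 e, 0 < e & z = of_real e.
Proof.
move=> z0; exists (scalar_abs z); last by rewrite scalar_absE gtr0_norm.
by rewrite -lt_of_real of_real0 scalar_absE gtr0_norm.
Qed.

Lemma scalar_abs_ge0 z : 0 <= scalar_abs z.
Proof. by rewrite -le_of_real of_real0 scalar_absE. Qed.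

Lemma scalar_abs0 : scalar_abs (0 : K) = 0.
Proof. by apply: of_real_inj; rewrite scalar_absE normr0 of_real0. Qed.

Lemma scalar_absD z z' :
  scalar_abs (z + z') <= scalar_abs z + scalar_abs z'.
Proof. by rewrite -le_of_real of_realD !scalar_absE ler_normD. Qed.

Lemma scalar_absM z z' : scalar_abs (z * z') = scalar_abs z * scalar_abs z'.
Proof. by apply: of_real_inj; rewrite of_realM !scalar_absE normrM. Qed.

Lemma scalar_abs_of_real x : scalar_abs (of_real x : K) = `|x|.
Proof.
case: F => //=; rewrite expr0n addr0.
by rewrite sqrtr_sqr.
Qed.

Lemma scalar_absN1 : scalar_abs (-1 : K) = 1.
Proof.
rewrite (_ : -1 = of_real (-1) :> K); last by case: F => //=; rewrite rmorphN1.
by rewrite scalar_abs_of_real normrN1.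
Qed.

End scalars_theory.

Record seminorm (R : realType) (F : scalar_field) (V : lmodType (scalars R F)) :=
  Seminorm {
    seminorm_fun :> V -> R ;
    seminormD : forall u v, seminorm_fun (u + v) <= seminorm_fun u + seminorm_fun v ;
    seminormZ : forall a u, seminorm_fun (a *: u) = scalar_abs a * seminorm_fun u
  }.

Section completion.
Context {R : realType} {F : scalar_field}.
Local Notation K := (scalars R F).
Context {V : lmodType K}.
Variable N : seminorm V.

Lemma seminorm0 : N 0 = 0.
Proof. by rewrite -(scale0r 0) seminormZ scalar_abs0 mul0r. Qed.

Lemma seminormN u : N (- u) = N u.
Proof. by rewrite -scaleN1r seminormZ scalar_absN1 mul1r. Qed.

Lemma seminormB u v : N (u - v) = N (v - u).
Proof. by rewrite -seminormN opprB. Qed.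

Lemma seminorm_ge0 u : 0 <= N u.
Proof.
have := seminormD N u (- u); rewrite subrr seminorm0 seminormN.
by rewrite -mulr2n pmulrn_lge0.
Qed.

Lemma seminorm_trans v u w : N (u - w) <= N (u - v) + N (v - w).
Proof. by rewrite (le_trans _ (seminormD _ _ _))// addrA subrK. Qed.

Lemma seminorm_dist u v : `|N u - N v| <= N (u - v).
Proof.
have H1 := seminormD N (u - v) v; have H2 := seminormD N (v - u) u.
rewrite !subrK (seminormB v u) in H1 H2.
by rewrite ler_norml; apply/andP; split; lra.
Qed.

(* The completion of [V] for [N]: Cauchy sequences of [V] modulo those whose
   seminorm tends to 0; in particular [N] need not separate points. *)
Definition cauchy_pred : {pred nat -> V} := fun u =>
  `[< forall e, 0 < e -> exists n0,
        forall m n, (n0 <= m)%N -> (n0 <= n)%N -> N (u m - u n) < e >].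

Lemma cauchy_pred_submod : submod_closed cauchy_pred.
Proof.
split.
  by apply/asboolP => e e0; exists 0%N => m n _ _; rewrite subrr seminorm0.
move=> a u v /asboolP Cu /asboolP Cv; apply/asboolP => e e0.
have a1 : 0 < scalar_abs a + 1 by rewrite ltr_wpDl// scalar_abs_ge0.
have [n1 H1] := Cu (e / 2 / (scalar_abs a + 1)) ltac:(by rewrite !divr_gt0).
have [n2 H2] := Cv (e / 2) ltac:(by rewrite divr_gt0).
exists (maxn n1 n2) => m n; rewrite !geq_max => /andP[m1 m2] /andP[k1 k2].
rewrite [u in N u](_ : _ = a *: (u m - u n) + (v m - v n)); last first.
  by rewrite scalerBr opprD addrACA.
rewrite (le_lt_trans (seminormD _ _ _))// [ltRHS]splitr ltr_leD//; last first.
  exact/ltW/H2.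
rewrite seminormZ.
rewrite (@le_lt_trans _ _ ((scalar_abs a + 1) * N (u m - u n)))//.
  by rewrite ler_wpM2r ?seminorm_ge0// lerDl.
by rewrite mulrC -ltr_pdivlMr// H1.
Qed.

HB.instance Definition _ :=
  GRing.isSubmodClosed.Build K (nat -> V) cauchy_pred cauchy_pred_submod.

Record cauchy_sequence := CauchySequence {
  cauchy_fun :> nat -> V ;
  cauchy_funP : cauchy_fun \in cauchy_pred
}.

HB.instance Definition _ := [isSub for cauchy_fun].
HB.instance Definition _ := [Choice of cauchy_sequence by <:].
HB.instance Definition _ := [SubChoice_isSubLmodule of cauchy_sequence by <:].

Lemma cauchy_seminorm_cvg (u : cauchy_sequence) : cvgn (fun n => N (u n)).
Proof.
apply: cauchy_cvg; apply: cauchy_exP => e e0.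
have /asboolP /(_ _ e0)[n0 H] := cauchy_funP u.
exists (N (u n0)), n0 => // n /= n0n.
rewrite -[ball _ _ _]/(is_true (`|N (u n0) - N (u n)| < e)).
by rewrite (le_lt_trans (seminorm_dist _ _))// H.
Qed.

Definition limit_seminorm (u : cauchy_sequence) : R := limn (fun n => N (u n)).

Lemma limit_seminorm_le (u : cauchy_sequence) c n0 :
  (forall n, (n0 <= n)%N -> N (u n) <= c) -> limit_seminorm u <= c.
Proof.
move=> uc; apply: limr_le; first exact: cauchy_seminorm_cvg.
by exists n0 => // n /= /uc.
Qed.

Lemma limit_seminormD u v :
  limit_seminorm (u + v) <= limit_seminorm u + limit_seminorm v.
Proof.
rewrite /limit_seminorm -limD; [|exact: cauchy_seminorm_cvg..].
apply: ler_lim; first exact: cauchy_seminorm_cvg.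
  by apply: is_cvgD; exact: cauchy_seminorm_cvg.
by apply: nearW => n; exact: seminormD.
Qed.

Lemma limit_seminormZ a u :
  limit_seminorm (a *: u) = scalar_abs a * limit_seminorm u.
Proof.
rewrite /limit_seminorm.
rewrite (_ : (fun n => N ((a *: u) n)) = (fun n => scalar_abs a * N (u n))).
  by apply/cvg_lim => //; apply: cvgMr; exact: cauchy_seminorm_cvg.
by apply/funext => n; exact: seminormZ.
Qed.

Lemma limit_seminorm0 : limit_seminorm 0 = 0.
Proof. by rewrite -(scale0r 0) limit_seminormZ scalar_abs0 mul0r. Qed.

Lemma limit_seminormN u : limit_seminorm (- u) = limit_seminorm u.
Proof. by rewrite -scaleN1r limit_seminormZ scalar_absN1 mul1r. Qed.

Lemma limit_seminorm_ge0 u : 0 <= limit_seminorm u.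
Proof.
have := limit_seminormD u (- u); rewrite subrr limit_seminorm0 limit_seminormN.
by rewrite -mulr2n pmulrn_lge0.
Qed.

Definition null_pred : {pred cauchy_sequence} :=
  fun u => limit_seminorm u == 0.

Lemma null_pred_zmod : zmod_closed null_pred.
Proof.
split; first by rewrite unfold_in limit_seminorm0.
move=> u v /eqP u0 /eqP v0; rewrite unfold_in eq_le limit_seminorm_ge0 andbT.
by rewrite (le_trans (limit_seminormD _ _))// limit_seminormN u0 v0 addr0.
Qed.

HB.instance Definition _ :=
  GRing.isZmodClosed.Build cauchy_sequence null_pred null_pred_zmod.

Definition completion := Quotient.quot null_pred.

HB.instance Definition _ := GRing.Zmodule.on completion.
HB.instance Definition _ := EqQuotient.on completion.

Local Open Scope quotient_scope.
Local Notation pi := (\pi_completion).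

Lemma completion_eqP (u v : cauchy_sequence) :
  reflect (limit_seminorm (u - v) = 0) (pi u == pi v).
Proof. by rewrite -Quotient.idealrBE; exact: eqP. Qed.

Lemma completion_piD : {morph pi : u v / u + v}.
Proof. exact: Quotient.pi_add. Qed.

Lemma completion_piN : {morph pi : u / - u}.
Proof. exact: Quotient.pi_opp. Qed.

Definition completion_scale (a : K) (x : completion) : completion :=
  pi (a *: repr x).

Lemma completion_piZ a u : completion_scale a (pi u) = pi (a *: u).
Proof.
apply/eqP/completion_eqP; rewrite -scalerBr limit_seminormZ.
have /eqP/completion_eqP -> := reprK (pi u).
by rewrite mulr0.
Qed.

Fact completion_scaleA a b x :
  completion_scale a (completion_scale b x) = completion_scale (a * b) x.
Proof. by rewrite -[x]reprK (completion_piZ b) !completion_piZ scalerA. Qed.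

Fact completion_scale1 : left_id 1 completion_scale.
Proof. by move=> x; rewrite -[x]reprK completion_piZ scale1r. Qed.

Fact completion_scaleDr : right_distributive completion_scale +%R.
Proof.
move=> a x y; rewrite -[x]reprK -[y]reprK -completion_piD !completion_piZ.
by rewrite scalerDr completion_piD.
Qed.

Fact completion_scaleDl x :
  {morph completion_scale^~ x : a b / a + b}.
Proof.
by move=> a b; rewrite -[x]reprK !completion_piZ scalerDl completion_piD.
Qed.

HB.instance Definition _ := GRing.Zmodule_isLmodule.Build K completion
  completion_scaleA completion_scale1 completion_scaleDr completion_scaleDl.

Definition completion_norm (x : completion) : K :=
  of_real (limit_seminorm (repr x)).

Lemma completion_norm_pi u : completion_norm (pi u) = of_real (limit_seminorm u).
Proof.
congr of_real; apply/eqP; rewrite eq_le.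
have /eqP/completion_eqP e := reprK (pi u).
have := limit_seminormD (repr (pi u) - u) u.
have := limit_seminormD (u - repr (pi u)) (repr (pi u)).
rewrite !subrK -(opprB (repr (pi u))) limit_seminormN e !add0r.
by move=> -> ->.
Qed.

Fact completion_normD x y :
  completion_norm (x + y) <= completion_norm x + completion_norm y.
Proof.
rewrite -[x]reprK -[y]reprK -completion_piD !completion_norm_pi -of_realD.
by rewrite le_of_real limit_seminormD.
Qed.

Fact completion_normZ a x :
  completion_norm (a *: x) = `|a| * completion_norm x.
Proof.
rewrite -[x]reprK [a *: _]completion_piZ !completion_norm_pi.
by rewrite limit_seminormZ of_realM scalar_absE.
Qed.

Fact completion_norm0_eq0 x : completion_norm x = 0 -> x = 0.
Proof.
rewrite -[x]reprK completion_norm_pi -of_real0 => /of_real_inj u0.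
have p0 : pi 0 = 0 by exact: pi_zeror.
by rewrite -p0; apply/eqP/completion_eqP; rewrite subr0.
Qed.

HB.instance Definition _ := Lmodule_isNormed.Build K completion
  completion_normD completion_normZ completion_norm0_eq0.

Fact const_cauchy (v : V) : (fun=> v) \in cauchy_pred.
Proof. by apply/asboolP => e e0; exists 0%N => *; rewrite subrr seminorm0. Qed.

Definition completion_embed (v : V) : completion :=
  pi (CauchySequence (const_cauchy v)).

Lemma completion_embed_linear : linear completion_embed.
Proof.
move=> a u v.
rewrite -[a *: completion_embed u]/(completion_scale a (pi _)) completion_piZ.
rewrite -completion_piD.
by congr (pi _); apply/val_inj/funext.
Qed.

HB.instance Definition _ := GRing.isLinear.Build K V completion _
  completion_embed completion_embed_linear.

Lemma completion_embed_norm v : `|completion_embed v| = of_real (N v).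
Proof.
rewrite [LHS]completion_norm_pi; congr of_real.
apply/cvg_lim => //; apply: cvg_cst; exact: eventually_filter.
Qed.

Lemma completion_pi_approx (u : cauchy_sequence) e : 0 < e ->
  exists n0, forall n, (n0 <= n)%N -> `|pi u - completion_embed (u n)| <= of_real e.
Proof.
move=> e0; have /asboolP /(_ _ e0)[n0 H] := cauchy_funP u.
exists n0 => n n0n.
rewrite -completion_piN -completion_piD [X in X <= _]completion_norm_pi le_of_real.
by apply: (@limit_seminorm_le _ _ n0) => m n0m; exact/ltW/H.
Qed.

Lemma completion_approx (x : completion) e : 0 < e ->
  exists v, `|x - completion_embed v| <= of_real e.
Proof.
move=> /(completion_pi_approx (repr x))[n0 /(_ _ (leqnn _))].
by rewrite reprK; exists (repr x n0).
Qed.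

Lemma completion_embed_dense : closure (range completion_embed) = setT.
Proof.
apply/seteqP; split => // x _ B /nbhs_ballP[e0 /= /of_real_pos[e e_gt0 ->]] xB.
have [v xv] := completion_approx x (divr_gt0 e_gt0 (ltr0Sn R 1)).
exists (completion_embed v); split; first by exists v.
apply: xB; rewrite -ball_normE /=.
apply: (le_lt_trans xv); rewrite lt_of_real.
by rewrite ltr_pdivrMr// ltr_pMr// ltr1n.
Qed.

Fact completion_complete (G : set_system completion) :
  ProperFilter G -> cauchy G -> cvg G.
Proof.
move=> GG /cauchyP Gc.
have /choice[v Gv] n : exists v : V,
    G (ball (completion_embed v) (of_real n.+1%:R^-1)).
  have n1 : 0 < n.+1%:R^-1 / 2 :> R by rewrite divr_gt0// invr_gt0.
  have [|x Gx] := Gc (of_real (n.+1%:R^-1 / 2)).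
    by rewrite -(@of_real0 R F) (@lt_of_real R F).
  have [v xv] := completion_approx x n1; exists v.
  apply: filterS Gx => y; rewrite -!ball_normE /= => xy.
  rewrite (splitr n.+1%:R^-1) of_realD.
  rewrite -(subrK x (completion_embed v)) -addrA.
  by rewrite (le_lt_trans (ler_normD _ _))// ler_ltD// distrC.
have vE m n : N (v m - v n) < m.+1%:R^-1 + n.+1%:R^-1.
  have [y []] := filter_ex (filterI (Gv m) (Gv n)).
  rewrite -!ball_normE /= => my ny.
  rewrite -(@lt_of_real R F) -completion_embed_norm raddfB of_realD /=.
  rewrite -(subrK y (completion_embed (v m))) -addrA.
  by rewrite (le_lt_trans (ler_normD _ _))// ltrD// distrC.
have vC : v \in cauchy_pred.
  apply/asboolP => e e0.
  have [k ke] : exists k, k.+1%:R^-1 < e / 2.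
    by have [k] := ltr_add_invr (divr_gt0 e0 (ltr0Sn R 1)); rewrite add0r; exists k.
  exists k => m n km kn; rewrite (lt_le_trans (vE m n))// (splitr e).
  by rewrite lerD// (le_trans _ (ltW ke))// lef_pV2 ?posrE// ler_nat ltnS.
apply/cvg_ex; exists (pi (CauchySequence vC)).
apply/cvg_ballP => e0 /of_real_pos[e e_gt0 ->].
have e2 : 0 < e / 2 by rewrite divr_gt0.
have [k ke] : exists k, k.+1%:R^-1 < e / 2.
  by have [k] := ltr_add_invr e2; rewrite add0r; exists k.
have [n0 Hn0] := completion_pi_approx (CauchySequence vC) e2.
have := Gv (maxn k n0); apply: filterS => y; rewrite -!ball_normE /= => vy.
rewrite (splitr e) of_realD.
rewrite -(subrK (completion_embed (v (maxn k n0))) (pi _)) -addrA.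
rewrite (le_lt_trans (ler_normD _ _))// ler_ltD//.
  by apply: Hn0; rewrite leq_maxr.
rewrite (lt_trans vy)// lt_of_real (le_lt_trans _ ke)//.
by rewrite lef_pV2 ?posrE// ler_nat ltnS leq_maxl.
Qed.

HB.instance Definition _ := Uniform_isComplete.Build completion completion_complete.

End completion.

Section muntz_span.
Context {R : realType} (F : scalar_field).
Local Notation K := (scalars R F).

(* Functions are defined on all of [R], but only their restrictions to [0, 1]
   enter [Lp_norm]; functions at distance 0 are identified in the completion. *)
Definition monomial (a : R) : R -> K^o := fun t => of_real (t `^ a).

Definition Lp_norm (p : R) (f : R -> K^o) : \bar R :=
  'N[lebesgue_measure]_p%:E[EFin \o ((scalar_abs \o f) \_ `[0, 1])%R]%E.

Definition muntz_span_pred (lambda : R^nat) : {pred R -> K^o} := fun f =>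
  `[< exists (n : nat) (c : nat -> K),
        f = \sum_(i < n) c i *: monomial (lambda i) >].

Lemma muntz_span_pred_submod (lambda : R^nat) :
  submod_closed (muntz_span_pred lambda).
Proof.
split; first by apply/asboolP; exists 0%N, (fun=> 0); rewrite big_ord0.
move=> a _ _ /asboolP[m [c ->]] /asboolP[n [d ->]]; apply/asboolP.
have pad k l (b : nat -> K) : (k <= l)%N ->
    \sum_(i < k) b i *: monomial (lambda i) =
    \sum_(i < l) (if (i < k)%N then b i else 0) *: monomial (lambda i).
  move=> kl.
  rewrite (big_ord_widen l (fun i => b i *: monomial (lambda i)) kl) big_mkcond.
  by apply: eq_bigr => i _; case: ifP => // _; rewrite scale0r.
exists (maxn m n), (fun i => a * (if (i < m)%N then c i else 0) +
                             (if (i < n)%N then d i else 0)).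
rewrite (pad m _ c (leq_maxl m n)) (pad n _ d (leq_maxr m n)).
rewrite scaler_sumr -big_split/=; apply: eq_bigr => i _.
by rewrite scalerA -scalerDl.
Qed.

HB.instance Definition _ (lambda : R^nat) := GRing.isSubmodClosed.Build
  K (R -> K^o) (muntz_span_pred lambda) (muntz_span_pred_submod lambda).

Record muntz_span (lambda : R^nat) := MuntzSpan {
  muntz_span_fun :> R -> K^o ;
  muntz_span_funP : muntz_span_fun \in muntz_span_pred lambda
}.

HB.instance Definition _ lambda := [isSub for @muntz_span_fun lambda].
HB.instance Definition _ lambda := [Choice of muntz_span lambda by <:].
HB.instance Definition _ lambda :=
  [SubChoice_isSubLmodule of muntz_span lambda by <:].

Lemma muntz_sumE n (c : nat -> K) (lambda : R^nat) t :
  (\sum_(i < n) c i *: monomial (lambda i)) t =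
  \sum_(i < n) c i * of_real (t `^ lambda i).
Proof. by rewrite fct_sumE. Qed.

Lemma measurable_abs_muntz_span lambda (f : muntz_span lambda) :
  measurable_fun setT (scalar_abs \o f).
Proof.
have /asboolP[n [c ->]] := muntz_span_funP f.
rewrite (_ : _ \o _ =
  fun t => scalar_abs (\sum_(i < n) c i * of_real (t `^ lambda i))); last first.
  by apply/funext => t /=; rewrite muntz_sumE.
move: c; rewrite /scalars; case: F => /= c.
  apply: measurableT_comp => //; apply: measurable_sum => i.
  by apply: measurable_funM => //; exact: measurable_powR.
have mM (x : R) i : measurable_fun setT (fun t : R => x * t `^ lambda i).
  by apply: measurable_funM => //; exact: measurable_powR.
rewrite (_ : (fun t => _) = fun t => Num.sqrt
    ((\sum_(i < n) complex.Re (c i) * t `^ lambda i) ^+ 2 +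
     (\sum_(i < n) complex.Im (c i) * t `^ lambda i) ^+ 2)).
  apply: measurableT_comp.
    by apply: continuous_measurable_fun; exact: sqrt_continuous.
  by apply: measurable_funD; apply: measurable_funX; apply: measurable_sum => i.
apply/funext => t /=.
rewrite (_ : \sum_(i < n) c i * _ =
  Complex (\sum_(i < n) complex.Re (c i) * t `^ lambda i)
          (\sum_(i < n) complex.Im (c i) * t `^ lambda i)) //.
elim/big_rec3: _ => // i x y z _ ->.
by case: (c i) => a b; apply/eqP; rewrite eq_complex /= !mulr0 subr0 add0r !eqxx.
Qed.

Lemma measurable_muntz_span lambda (f : muntz_span lambda) :
  measurable_fun setT ((scalar_abs \o f) \_ `[0, 1]).
Proof.
apply/(measurable_restrict _ _ _).1 => //; rewrite setTI.
by apply: measurable_funTS; exact: measurable_abs_muntz_span.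
Qed.

Local Notation leb := (@lebesgue_measure R).

Lemma Lnorm_le p (g h : R -> R) : 1 <= p ->
    measurable_fun setT g -> measurable_fun setT h ->
    (forall t, 0 <= g t <= h t) ->
  ('N[leb]_p%:E[EFin \o g] <= 'N[leb]_p%:E[EFin \o h])%E.
Proof.
move=> p1 mg mh gh; have p0 : 0 <= p by rewrite (le_trans _ p1).
have mp (k : R -> R) : measurable_fun setT k ->
    measurable_fun setT (fun t => (`|(EFin \o k) t| `^ p)%E).
  move=> mk; apply/measurable_EFinP.
  apply: (measurableT_comp (measurable_powR p)).
  exact: measurableT_comp.
rewrite unlock /Lnorm; apply: gt0_ler_poweR; first by rewrite invr_ge0.
- by rewrite in_itv/= leey andbT integral_ge0// => t _; exact: poweR_ge0.
- by rewrite in_itv/= leey andbT integral_ge0// => t _; exact: poweR_ge0.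
apply: ge0_le_integral => //; [|exact: mp|exact: mp|].
  by move=> t _; exact: poweR_ge0.
move=> t _; have /andP[g0 gth] := gh t.
have h0 := le_trans g0 gth.
by rewrite /= lee_fin ge0_ler_powR ?nnegrE ?normr_ge0// !ger0_norm.
Qed.

Lemma abs_muntz_span_bounded lambda (f : muntz_span lambda) :
  (forall n, 0 < lambda n) ->
  exists C, forall t, t \in `[0, 1] -> scalar_abs (f t) <= C.
Proof.
move=> lambda0; have /asboolP[n [c ->]] := muntz_span_funP f.
exists (\sum_(i < n) scalar_abs (c i)) => t.
rewrite in_itv/= => /andP[t0 t1]; rewrite muntz_sumE.
elim/big_rec2: _ => [|i x y _ yx]; first by rewrite scalar_abs0.
rewrite (le_trans (scalar_absD _ _))// lerD// scalar_absM scalar_abs_of_real.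
rewrite ler_piMr ?scalar_abs_ge0// ger0_norm ?powR_ge0//.
rewrite -[leRHS](_ : 1 `^ lambda i = 1); last by rewrite powR1.
by rewrite ge0_ler_powR ?nnegrE// ltW.
Qed.

Lemma Lp_norm_fin lambda p (f : muntz_span lambda) : 1 <= p ->
  (forall n, 0 < lambda n) -> Lp_norm p f \is a fin_num.
Proof.
move=> p1 /(abs_muntz_span_bounded f)[C fC].
have C0 : 0 <= C.
  by rewrite (le_trans (scalar_abs_ge0 (f 0)))// fC// in_itv/= lexx ler01.
have p_neq0 : p != 0 by rewrite gt_eqF// (lt_le_trans _ p1).
rewrite ge0_fin_numE ?Lnorm_ge0//.
apply: (@le_lt_trans _ _ ('N[leb]_p%:E[EFin \o (cst C \_ `[0, 1])%R])%E).
  apply: Lnorm_le => //; first exact: measurable_muntz_span.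
    by apply/(measurable_restrict _ _ _).1.
  move=> t; rewrite !patchE; case: ifPn => [|_]; last by rewrite !lexx.
  by rewrite inE /= => /fC ->; rewrite scalar_abs_ge0.
rewrite unlock /Lnorm; apply: poweR_lty.
rewrite (_ : (fun t => _) = (cst (C `^ p)%:E \_ `[0%R, 1%R])%E).
  rewrite -integral_mkcond integral_cst//.
  have leb1 : (leb `[0%R, 1%R] < +oo)%E
    by rewrite lebesgue_measure_itv/= lte01 ltry.
  by apply: lte_mul_pinfty; rewrite ?lee_fin ?powR_ge0.
apply/funext => t /=; rewrite !patchE; case: ifPn => _ /=.
  by rewrite ger0_norm.
by rewrite normr0 powR0.
Qed.

Lemma Lp_normD lambda p (f g : muntz_span lambda) : 1 <= p ->
  (Lp_norm p (f + g)%R <= Lp_norm p f + Lp_norm p g)%E.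
Proof.
move=> p1; have mf := measurable_muntz_span f; have mg := measurable_muntz_span g.
have := @minkowski_EFin _ _ _ leb _ _ _ mf mg p1; rewrite -/(Lp_norm p f).
rewrite -/(Lp_norm p g); apply: le_trans.
apply: Lnorm_le => //; first exact: (measurable_muntz_span (f + g)).
  exact: measurable_funD.
move=> t /=; rewrite !patchE; case: ifPn => _; last by rewrite addr0 lexx.
by rewrite scalar_abs_ge0 scalar_absD.
Qed.

Lemma Lp_normZ lambda p a (f : muntz_span lambda) : 1 <= p ->
  Lp_norm p (a *: f)%R = ((scalar_abs a)%:E * Lp_norm p f)%E.
Proof.
move=> p1; have p_neq0 : p != 0 by rewrite gt_eqF// (lt_le_trans _ p1).
rewrite /Lp_norm unlock /Lnorm.
have a0 := scalar_abs_ge0 a.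
rewrite (_ : (scalar_abs a)%:E = ((scalar_abs a `^ p)%:E `^ p^-1)%E); last first.
  by rewrite poweR_EFin -powRrM mulfV// powRr1.
rewrite -poweRM ?lee_fin ?powR_ge0 ?integral_ge0//; last first.
  by move=> t _; exact: poweR_ge0.
congr (_ `^ _)%E; rewrite -ge0_integralZl//; first last.
- by rewrite lee_fin powR_ge0.
- by move=> t _; exact: poweR_ge0.
- apply/measurable_EFinP; apply: (measurableT_comp (measurable_powR p)).
  apply: measurableT_comp => //; exact: measurable_muntz_span.
apply: eq_integral => t _; rewrite /= !patchE; case: ifPn => _ /=.
  rewrite -EFinM; congr (_%:E).
  rewrite -powRM ?normr_ge0//; congr (_ `^ _).
  by rewrite [in LHS]scalar_absM normrM (ger0_norm a0).
by rewrite normr0 powR0// mule0.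
Qed.

End muntz_span.

Section muntz_space.
Context {R : realType} (F : scalar_field).
Variables (p : R) (p1 : 1 <= p).
Variables (lambda : R^nat) (lambda_gt0 : forall n, 0 < lambda n).
Local Notation V := (muntz_span F lambda).

Definition muntz_seminorm_fun (f : V) : R := fine (Lp_norm p f).

Fact muntz_seminormD (f g : V) :
  muntz_seminorm_fun (f + g) <= muntz_seminorm_fun f + muntz_seminorm_fun g.
Proof.
rewrite -lee_fin EFinD /muntz_seminorm_fun !fineK ?Lp_norm_fin//.
exact: Lp_normD.
Qed.

Fact muntz_seminormZ a (f : V) :
  muntz_seminorm_fun (a *: f) = scalar_abs a * muntz_seminorm_fun f.
Proof. by rewrite /muntz_seminorm_fun Lp_normZ// fineM// Lp_norm_fin. Qed.

Definition muntz_seminorm : seminorm V :=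
  Seminorm muntz_seminormD muntz_seminormZ.

Definition muntz_space : completeNormedModType (scalars R F) :=
  completion muntz_seminorm.

Lemma muntz_space_is_completion : exists i : {linear V -> muntz_space},
  (forall f, `|i f| = of_real (fine (Lp_norm p f))) /\ closure (range i) = setT.
Proof.
exists (completion_embed muntz_seminorm); split; last first.
  exact: completion_embed_dense.
by move=> f; exact: completion_embed_norm.
Qed.

End muntz_space.
Arguments muntz_space {R} F {p} p1 {lambda} lambda_gt0.

(* Sequences are indexed from 0: [lambda n] is the (n+1)-st exponent. *)
Definition gap_condition (R : realType) (lambda : R^nat) : Prop :=
  (0 < ereal_inf (range (fun n => (lambda n.+1 - lambda n)%:E)))%E.

Definition muntz_condition (R : realType) (lambda : R^nat) : Prop :=
  cvgn (series (fun n => (lambda n)^-1)).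

Definition isomorphic (K : numFieldType) (V W : completeNormedModType K) : Prop :=
  exists (f : {linear V -> W}) (g : W -> V),
    [/\ cancel f g, cancel g f, continuous f & continuous g].

(* Main.v *)
From HB Require Import structures.
Require Import Defs.
From mathcomp Require Import all_boot all_order all_algebra.
From mathcomp Require Import generic_quotient ring_quotient.
From mathcomp Require Import all_classical all_reals all_analysis.
From mathcomp Require Import measurable_realfun.
From mathcomp Require Import complex ring lra.
Import Order.TTheory GRing.Theory Num.Theory.
Import numFieldNormedType.Exports.
Local Open Scope classical_set_scope.
Local Open Scope ring_scope.

(* With t = exp(-s), t^a becomes exp(-a s), whose Laplace transform is
   1/(z + a). Multiplying Laplace transforms by (z + l_k)/(z + u_k) moves the
   pole at -l_k to -u_k and keeps the other poles, so it maps the span of the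
   t^(l_k) and t^(e_i), i <> k, into that of t^(u_k) and the t^(e_i). On
   functions this is I - (u_k - l_k) C with C f(t) = int_t^1 (t/x)^(u_k) f(x)
   dx/x, an operator of L_p-norm at most 1/u_k. Its inverse is of the same form
   with l_k and u_k exchanged. The infinite product of these operators and that
   of their inverses converge because sum_k (u_k - l_k)/l_k < oo; the limit is
   an isomorphism. It does not map t^(l_k) to t^(u_k). *)

Set Implicit Arguments.
Unset Strict Implicit.

(** * A Hardy inequality *)

(** The convex function $x^p$ lies above its tangent at $m$. For $p>1$ this is Young's inequality
    for $x$ and $m^{p-1}$ with exponents $p$ and $p/(p-1)$; for $p=1$, where the conjugate exponent
    is infinite, both sides equal $x$. *)
Lemma powR_tangent (R : realType) (p x m : R) : 1 <= p -> 0 <= x -> 0 <= m ->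
  p * (x * m `^ (p - 1)) <= x `^ p + (p - 1) * m `^ p.
Proof.
rewrite le_eqVlt => /predU1P[<-|p1] x0 m0.
  by rewrite subrr powRr0 powRr1// mulr1 mul1r mul0r addr0.
have p0 : 0 < p by lra.
have q0 : 0 < p / (p - 1) by rewrite divr_gt0//; lra.
have := @conjugate_powR _ x (m `^ (p - 1)) p (p / (p - 1)) x0 (powR_ge0 _ _) p0 q0.
rewrite -powRrM (_ : (p - 1) * (p / (p - 1)) = p); last by field; lra.
move=> H; rewrite -(ler_pM2l (_ : 0 < p^-1)) ?invr_gt0// mulKf ?gt_eqF//.
apply: le_trans (H _) _; first by field; apply/andP; split; lra.
rewrite le_eqVlt; apply/orP; left; apply/eqP; field; apply/andP; split; lra.
Qed.

Section hardy.
Context {R : realType}.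
Local Notation mu := (@lebesgue_measure R).

Lemma integral_derivative (h k : R -> R) (s x : R) : 0 < s -> s <= x ->
  (forall y : R, 0 < y -> is_derive y 1 h (k y)) ->
  (forall y : R, 0 < y -> {for y, continuous k}) ->
  (\int[mu]_(y in `[s, x]) (k y)%:E = (h x - h s)%:E)%E.
Proof.
move=> s0; rewrite le_eqVlt => /predU1P[<-|sx] hk ck.
  by rewrite set_itv1 integral_set1 subrr.
have dh y : 0 < y -> derivable h y 1 by move=> /hk [].
have ch y : 0 < y -> {for y, continuous h}.
  by move=> /dh/derivable1_diffP/differentiable_continuous.
have x0 := lt_trans s0 sx.
rewrite (@continuous_FTC2 _ k h)// ?EFinB//.
- apply: continuous_in_subspaceT => y; rewrite inE/= in_itv/= => /andP[sy _].
  by apply: ck; exact: lt_le_trans sy.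
- split.
  + by move=> y; rewrite in_itv/= => /andP[sy _]; apply: dh; exact: lt_trans sy.
  + by apply: cvg_at_right_filter; exact: ch.
  + by apply: cvg_at_left_filter; exact: ch.
- move=> y; rewrite in_itv/= => /andP[sy _]; rewrite derive1E.
  by have [_ ->] := hk _ (lt_trans s0 sy).
Qed.

Lemma powR_continuous (r y : R) : 0 < y -> {for y, continuous (@powR R ^~ r)}.
Proof.
move=> y0; apply/differentiable_continuous/derivable1_diffP.
by apply: derivable_powR; rewrite in_itv/= y0.
Qed.

Lemma integral_powR (r s x : R) : r != 0 -> 0 < s -> s <= x ->
  (\int[mu]_(y in `[s, x]) (y `^ (r - 1))%:E =
   ((x `^ r - s `^ r) / r)%:E)%E.
Proof.
move=> r0 s0 sx.
have dh (y : R) : 0 < y ->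
    is_derive y 1 (fun y : R => r^-1 * y `^ r) (y `^ (r - 1)).
  move=> y0; apply: is_derive_eq.
    by apply: is_deriveM; exact: is_derive1_powR.
  by rewrite /GRing.scale/= mulr0 addr0 mulrA mulVf// mul1r.
rewrite (integral_derivative s0 sx dh) => [|y y0]; last exact: powR_continuous.
by rewrite -mulrBr mulrC.
Qed.

Lemma integral_powR0 (a x : R) : 0 < a -> 0 < x ->
  (\int[mu]_(t in `]0%R, x]) (t `^ a)%:E = (x `^ (a + 1) / (a + 1))%:E)%E.
Proof.
move=> a0 x0; have a1 : 0 < a + 1 by lra.
have pos y : y \in `]0, x[ -> 0 < y by rewrite in_itv/= => /andP[].
have dh (y : R) : 0 < y ->
    is_derive y 1 (fun y : R => (a + 1)^-1 * y `^ (a + 1)) (y `^ a).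
  move=> y0; apply: is_derive_eq.
    by apply: is_deriveM; exact: is_derive1_powR.
  by rewrite /GRing.scale/= mulr0 addr0 mulrA mulVf ?gt_eqF// mul1r addrK.
(* Adding the endpoint 0 is harmless: the antiderivative is continuous there because $a+1>0$. *)
rewrite integral_itv_obnd_cbnd; last first.
  by apply/measurable_EFinP/measurable_funTS; exact: measurable_powR.
rewrite (@continuous_FTC2 _ _ (fun y : R => (a + 1)^-1 * y `^ (a + 1)))//.
- by rewrite powR0 ?gt_eqF// mulr0 sube0 mulrC.
- apply/continuous_within_itvP => //; split.
  + by move=> y /pos; exact: powR_continuous.
  + by rewrite powR0 ?gt_eqF//; exact: powR_cvg0.
  + by apply: cvg_at_left_filter; exact: powR_continuous.
- split.
  + by move=> y /pos /dh [].
  + rewrite powR0 ?gt_eqF//; apply: cvgMr; exact: powR_cvg0.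
  + by apply: cvg_at_left_filter; apply: cvgMr; exact: powR_continuous.
- by move=> y /pos y0; rewrite derive1E; have [_ ->] := dh _ y0.
Qed.

Variables (p a : R) (p1 : 1 <= p) (a0 : 0 < a).
(** Kernel of $aC$, where $C$ is the averaging operator with exponent $a$. Its mass is $1-t^a$ in
    $x$ over $[t,1]$ and $a/(a+1)$ in $t$ over $]0,x]$. Both are at most 1, which is what makes $aC$
    a contraction of $L_p$. *)
Let k (t x : R) := a * (t `^ a * x `^ (- a - 1)).

Let k_ge0 t x : 0 <= k t x.
Proof. by rewrite /k !mulr_ge0 ?powR_ge0// ltW. Qed.

Let measurable_k t : measurable_fun setT (k t).
Proof.
by apply: measurable_funM => //; apply: measurable_funM => //; exact: measurable_powR.
Qed.

Let integral_k (t : R) : 0 < t -> t <= 1 ->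
  (\int[mu]_(x in `[t, 1%R]) (k t x)%:E <= 1)%E.
Proof.
move=> t0 t1; rewrite /k.
under eq_integral do rewrite mulrA EFinM.
rewrite ge0_integralZl//=; last 3 first.
- apply/measurable_EFinP/measurable_funTS; exact: measurable_powR.
- by move=> x _; rewrite lee_fin powR_ge0.
- by rewrite lee_fin mulr_ge0 ?powR_ge0// ltW.
rewrite integral_powR ?oppr_eq0 ?gt_eqF// -EFinM lee_fin powR1.
have ta := powR_gt0 a t0; rewrite powRN.
rewrite (_ : _ * _ = 1 - t `^ a); first by lra.
by field; rewrite !gt_eqF.
Qed.

Let integral_k2 (x : R) : 0 < x ->
  (\int[mu]_(t in `]0%R, x]) (k t x)%:E <= 1)%E.
Proof.
move=> x0; rewrite /k.
under eq_integral do rewrite mulrA mulrAC EFinM.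
have mp : measurable_fun [set: R] (fun t : R => (t `^ a)%:E).
  by apply/measurable_EFinP; exact: measurable_powR.
rewrite ge0_integralZl//=; last 3 first.
- exact: measurable_funTS.
- by move=> t _; rewrite lee_fin powR_ge0.
- by rewrite lee_fin mulr_ge0 ?powR_ge0// ltW.
rewrite integral_powR0// -EFinM lee_fin (_ : - a - 1 = - (a + 1)); last by ring.
rewrite powRN; have xa := powR_gt0 (a + 1) x0.
by rewrite mulrA divfK ?gt_eqF// ler_pdivrMr ?addr_gt0// mul1r lerDl.
Qed.


Variables (u F : R -> R).
Hypotheses (measurable_u : measurable_fun setT u) (mF : measurable_fun setT F).
Hypotheses (u0 : forall t, 0 <= u t) (F0 : forall x, 0 <= F x).

Let measurable_kF (t : R) : measurable_fun setT (fun x => (k t x * F x `^ p)%:E).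
Proof.
apply/measurable_EFinP/measurable_funM; first exact: measurable_k.
exact: (measurableT_comp (measurable_powR p)).
Qed.

(* Jensen's inequality for the sub-probability density [k t] on [t, 1]. *)
Let jensen (t : R) : 0 < t -> t <= 1 ->
  ((a * u t)%:E <= \int[mu]_(x in `[t, 1%R]) (k t x * F x)%:E)%E ->
  (((a * u t) `^ p)%:E <= \int[mu]_(x in `[t, 1%R]) (k t x * F x `^ p)%:E)%E.
Proof.
move=> t0 t1; set m := a * u t => mle.
have m0 : 0 <= m by rewrite mulr_ge0// ltW.
have p0 : 0 < p by exact: lt_le_trans p1.
have mp0 : 0 <= m `^ p by exact: powR_ge0.
have mq0 : 0 <= p * m `^ (p - 1) by rewrite mulr_ge0 ?powR_ge0// ltW.
(* Once the subtracted term is moved across, the claim is [powR_tangent] integrated against [k t].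
   The constant term $(p-1)m^p$ is nonnegative, so a mass of at most 1 suffices. *)
rewrite (_ : m `^ p = p * m `^ (p - 1) * m - (p - 1) * m `^ p); last first.
  by rewrite -mulrA (mulrC (_ `^ _) m) mulr_powRB1//; ring.
rewrite EFinB leeBlDr// EFinM.
have mk : measurable_fun [set: R] (fun x => (k t x)%:E).
  by apply/measurable_EFinP; exact: measurable_k.
have mck : measurable_fun [set: R] (fun x => ((p - 1) * m `^ p)%:E * (k t x)%:E)%E.
  exact: measurable_funeM.
have mS : measurable_fun [set: R]
    (fun x => (k t x * F x `^ p)%:E + ((p - 1) * m `^ p)%:E * (k t x)%:E)%E.
  exact: emeasurable_funD.
have mkF := measurable_kF t.
have H : ((p * m `^ (p - 1))%:E * m%:E <=
    \int[mu]_(x in `[t, 1%R]) ((k t x * F x `^ p)%:E +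
      ((p - 1) * m `^ p)%:E * (k t x)%:E))%E.
  rewrite (le_trans (lee_wpmul2l _ mle)) ?lee_fin//.
  rewrite -ge0_integralZl//=; last 2 first.
  - apply/measurable_EFinP; apply: measurable_funTS.
    by apply: measurable_funM => //; exact: measurable_k.
  - by move=> x _; rewrite lee_fin mulr_ge0.
  apply: ge0_le_integral => //=.
  - by move=> x _; rewrite -EFinM lee_fin mulr_ge0// mulr_ge0.
  - apply/measurable_EFinP; apply: measurable_funTS.
    apply: measurable_funM => //; apply: measurable_funM => //.
    exact: measurable_k.
  - exact: measurable_funTS.
  - move=> x _; rewrite -!EFinM -EFinD lee_fin.
    have := ler_wpM2l (k_ge0 t x) (powR_tangent p1 (F0 x) m0).
    rewrite mulrDr [X in X <= _](_ : _ = p * m `^ (p - 1) * (k t x * F x)); last by ring.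
    by rewrite (mulrC (k t x) ((p - 1) * _)).
apply: (le_trans H).
have q0 : 0 <= (p - 1) * m `^ p by rewrite mulr_ge0// subr_ge0.
rewrite ge0_integralD//=; last 4 first.
- by move=> x _; rewrite lee_fin mulr_ge0// powR_ge0.
- exact: measurable_funTS.
- by move=> x _; rewrite -EFinM lee_fin mulr_ge0.
- exact: measurable_funTS.
rewrite leeD2l// ge0_integralZl//=; last 2 first.
- exact: measurable_funTS.
- by move=> x _; rewrite lee_fin.
by rewrite -[leRHS]mule1 lee_wpmul2l ?lee_fin// integral_k.
Qed.

(** The integrand extended by 0 outside the triangle $0<t\le x\le 1$, so that Tonelli's theorem
    applies on the whole plane. *)
Let Phi (t x : R) : \bar R :=
  if [&& 0 < t, t <= x & x <= 1] then (k t x * F x `^ p)%:E else 0%E.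

Let Phi_ge0 t x : (0 <= Phi t x)%E.
Proof. by rewrite /Phi; case: ifPn => // _; rewrite lee_fin mulr_ge0 ?powR_ge0. Qed.

Let measurable_Phi : measurable_fun setT (fun z : R * R => Phi z.1 z.2).
Proof.
apply: measurable_fun_ifT => //=.
  apply: measurable_and; first by apply: measurable_fun_ltr.
  by apply: measurable_and; apply: measurable_fun_ler.
apply/measurable_EFinP; apply: measurable_funM; last first.
  exact: (measurableT_comp (measurable_powR p) (measurableT_comp mF _)).
apply: measurable_funM => //; apply: measurable_funM.
  exact: (measurableT_comp (measurable_powR _)).
exact: (measurableT_comp (measurable_powR _)).
Qed.

Let Phi_x (t : R) : 0 < t -> t <= 1 ->
  (\int[mu]_x Phi t x = \int[mu]_(x in `[t, 1%R]) (k t x * F x `^ p)%:E)%E.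
Proof.
move=> t0 t1; rewrite [RHS]integral_mkcond; apply: eq_integral => x _.
rewrite patchE /Phi t0/=; case: ifPn => [tx|/negP tx].
  by rewrite ifT// inE/= in_itv.
by rewrite ifF//; apply/negP; rewrite inE/= in_itv.
Qed.

Let Phi_t (x : R) : (\int[mu]_t Phi t x <= ((fun x => (F x `^ p)%:E) \_ `[0%R, 1%R]) x)%E.
Proof.
rewrite patchE; have [x01|x01] := boolP (0 < x <= 1); last first.
  rewrite [leLHS](_ : _ = 0%E).
    by case: ifPn => // _; rewrite lee_fin powR_ge0.
  apply: integral0_eq => t _; rewrite /Phi ifF//; apply/negP => /and3P[t0 tx x1].
  by move/negP: x01; apply; rewrite x1 (lt_le_trans t0 tx).
have [x0 x1] := andP x01.
rewrite ifT; last by rewrite inE/= in_itv/= x1 ltW.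
rewrite (_ : (\int[mu]_t _)%E = (\int[mu]_(t in `]0%R, x]) ((F x `^ p)%:E * (k t x)%:E))%E).
  rewrite ge0_integralZl//=; last 3 first.
  - apply/measurable_EFinP/measurable_funTS; apply: measurable_funM => //.
    by apply: measurable_funM => //; exact: measurable_powR.
  - by move=> t _; rewrite lee_fin.
  - by rewrite lee_fin powR_ge0.
  by rewrite -[leRHS]mule1 lee_wpmul2l ?lee_fin ?powR_ge0// integral_k2.
rewrite [RHS]integral_mkcond; apply: eq_integral => t _.
rewrite patchE /Phi x1 andbT; case: ifPn => [tx|/negP tx].
  by rewrite ifT ?inE/= ?in_itv// mulrC EFinM.
by rewrite ifF//; apply/negP; rewrite inE/= in_itv.
Qed.

(** Jensen bounds the left side by a double integral; after Tonelli, the mass of [k] in $t$ is at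
    most 1. Only a domination of [u] is assumed, so that absolute values of scalar functions can be
    inserted. *)
Lemma hardy :
  (forall t, 0 < t -> t <= 1 ->
    ((a * u t)%:E <= \int[mu]_(x in `[t, 1%R])
       (a * (t `^ a * x `^ (- a - 1)) * F x)%:E)%E) ->
  (\int[mu]_(t in `[0%R, 1%R]) ((a * u t) `^ p)%:E <=
   \int[mu]_(x in `[0%R, 1%R]) (F x `^ p)%:E)%E.
Proof.
move=> uF.
have mup : measurable_fun [set: R] (fun t => ((a * u t) `^ p)%:E).
  apply/measurable_EFinP; apply: (measurableT_comp (measurable_powR p)).
  exact: measurable_funM.
(* The point $t=0$, where the domination is not assumed, is a null set. *)
rewrite -integral_itv_obnd_cbnd; last exact: measurable_funTS.
have mPhi1 : measurable_fun [set: R] (fun t => (\int[mu]_x Phi t x)%E).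
  exact: (@measurable_fun_fubini_tonelli_F _ _ _ _ R mu (fun z => Phi z.1 z.2)).
apply: (@le_trans _ _ (\int[mu]_(t in `]0%R, 1%R]) \int[mu]_x Phi t x)%E).
  apply: ge0_le_integral => //=.
  - by move=> t _; rewrite lee_fin powR_ge0.
  - exact: measurable_funTS.
  - exact: measurable_funTS.
  - move=> t; rewrite in_itv/= => /andP[t0 t1].
    by rewrite Phi_x// jensen// uF.
apply: (@le_trans _ _ (\int[mu]_t \int[mu]_x Phi t x)%E).
  by apply: ge0_subset_integral => // t _; exact: integral_ge0.
rewrite (@fubini_tonelli _ _ _ _ R mu mu (fun z => Phi z.1 z.2))//=.
rewrite [leRHS]integral_mkcond; apply: ge0_le_integral => //=.
- by move=> t _; exact: integral_ge0.
- exact: (@measurable_fun_fubini_tonelli_G _ _ _ _ R mu (fun z => Phi z.1 z.2)).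
- apply/(measurable_restrict _ _ _).1 => //; apply: measurable_funTS.
  by apply/measurable_EFinP; exact: (measurableT_comp (measurable_powR p)).
Qed.

End hardy.

(** * Pointwise bound for the averaging operator *)

(** A real-linear functional of norm at most 1 that is norming at [z0]: the real part of $wz$ with
    $w=|z_0|/z_0$. It reduces the modulus of a scalar-valued integral to real integrals, for both
    choices of [F]. *)
Lemma scalar_functional (R : realType) (F : scalar_field) (z0 : scalars R F) :
  exists rho : scalars R F -> R,
    [/\ {morph rho : z w / z + w}, rho 0 = 0,
        forall z x, rho (z * of_real x) = rho z * x,
        forall z, `|rho z| <= scalar_abs z & rho z0 = scalar_abs z0].
Proof.
have [re [reD re0 reM re_le reE]] : exists re : scalars R F -> R,
    [/\ {morph re : z w / z + w}, re 0 = 0,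
        forall z x, re (z * of_real x) = re z * x,
        forall z, `|re z| <= scalar_abs z & forall x, re (of_real x) = x].
  case: F z0 => _ /=.
    by exists id; split.
  exists (@complex.Re R); split => //=.
  - by move=> [a b] [c d].
  - by move=> [a b] x /=; rewrite mulr0 subr0.
  - by move=> z; rewrite -lecR (le_trans (normc_ge_Re z)).
have [z00|z00] := eqVneq z0 0.
  exists re; split=> //; by rewrite z00 re0 scalar_abs0.
pose w := of_real (scalar_abs z0) / z0.
have w1 : scalar_abs w = 1.
  apply: (@of_real_inj R F); rewrite scalar_absE normf_div scalar_absE normr_id.
  by rewrite divff ?normr_eq0//; case: (F).
exists (fun z => re (w * z)); split.
- by move=> z z'; rewrite mulrDr reD.
- by rewrite mulr0.
- by move=> z x; rewrite mulrA reM.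
- by move=> z; rewrite (le_trans (re_le _))// scalar_absM w1 mul1r.
- by rewrite /w divfK// reE.
Qed.

Section pointwise.
Context {R : realType} {F : scalar_field}.
Local Notation K := (scalars R F).
Local Notation mu := (@lebesgue_measure R).

Lemma integral_powR_sum n (b e : nat -> R) (a t : R) :
  (forall i, (i < n)%N -> e i != a) -> 0 < t -> t <= 1 ->
  (\int[mu]_(x in `[t, 1%R]) (\sum_(i < n) b i * x `^ (e i - a - 1))%:E =
   (\sum_(i < n) b i * ((1 - t `^ (e i - a)) / (e i - a)))%:E)%E.
Proof.
move=> ea t0 t1.
pose h (x : R) := \sum_(i < n) (b i * (e i - a)^-1) * x `^ (e i - a).
have dh (y : R) : 0 < y -> is_derive y 1 h (\sum_(i < n) b i * y `^ (e i - a - 1)).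
  move=> y0.
  rewrite (_ : h = \sum_(i < n) (fun x : R => (b i * (e i - a)^-1) * x `^ (e i - a))); last first.
    by apply/funext => x; rewrite fct_sumE.
  apply: is_derive_sum => i; apply: is_derive_eq.
    by apply: is_deriveM; exact: is_derive1_powR.
  rewrite /GRing.scale/= mulr0 addr0 -!mulrA mulKf// subr_eq0; exact: ea.
rewrite (integral_derivative t0 t1 dh).
  rewrite /h -sumrB; congr (_%:E); apply: eq_bigr => i _.
  by rewrite powR1 -mulrBr -!mulrA (mulrC (_^-1)).
move=> y y0; apply: cvg_big => [|i _]; first exact: add_continuous.
by apply: cvgMr; exact: powR_continuous.
Qed.

(** The left side is $|Cf(t)|$ for $f=\sum_i c_i t^{e_i}$, with $C$ already evaluated on each
    monomial, so no scalar-valued integral is needed. A functional norming at $Cf(t)$ is moved under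
    the integral and bounded there by $|f|$. *)
Lemma pointwise_bound n (c : nat -> K) (e : nat -> R) (a t : R) :
  (forall i, (i < n)%N -> e i != a) -> 0 < t -> t <= 1 ->
  measurable_fun setT (fun x : R => scalar_abs (\sum_(i < n) c i * of_real (x `^ e i))) ->
  ((scalar_abs (\sum_(i < n) c i * of_real ((t `^ e i - t `^ a) / (a - e i))))%:E
   <= \int[mu]_(x in `[t, 1%R]) (t `^ a * x `^ (- a - 1) *
        scalar_abs (\sum_(i < n) c i * of_real (x `^ e i)))%:E)%E.
Proof.
move=> ea t0 t1 mf; set g := \sum_(i < n) _.
have [rho [rhoD rho0 rhoM rho_le <-]] := scalar_functional g.
have rho_sum m (d : nat -> K) (y : nat -> R) :
    rho (\sum_(i < m) d i * of_real (y i)) = \sum_(i < m) rho (d i) * y i.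
  by rewrite (big_morph rho rhoD rho0); apply: eq_bigr => i _; rewrite rhoM.
(* Termwise, $\int_t^1 t^a x^{e_i-a-1}\,dx=(t^{e_i}-t^a)/(a-e_i)$. *)
have -> : (rho g)%:E = (\int[mu]_(x in `[t, 1%R])
    (t `^ a * \sum_(i < n) rho (c i) * x `^ (e i - a - 1))%:E)%E.
  under eq_integral do rewrite mulr_sumr.
  under eq_integral => x _ do under eq_bigr => i _ do rewrite mulrA.
  rewrite (@integral_powR_sum n (fun i => t `^ a * rho (c i)))//.
  rewrite (rho_sum n c (fun i => (t `^ e i - t `^ a) / (a - e i))); congr (_%:E).
  apply: eq_bigr => i _; rewrite (mulrC (t `^ a)) -!mulrA; congr (_ * _).
  rewrite mulrA mulrBr mulr1 -powRD; last by rewrite (gt_eqF t0) implybT.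
  by rewrite subrKC -(opprB (t `^ e i)) -(opprB a) invrN mulrNN.
have mpow r : measurable_fun [set: R] (fun x => x `^ r) by exact: measurable_powR.
apply: (le_trans (lee_abs _)); apply: (le_trans (le_abse_integral _ _ _)) => //.
  apply/measurable_EFinP/measurable_funTS; apply: measurable_funM => //.
  by apply: measurable_sum => i; exact: measurable_funM.
apply: ge0_le_integral => //=.
- apply/measurable_EFinP/measurable_funTS; apply: measurableT_comp => //.
  apply: measurable_funM => //.
  by apply: measurable_sum => i; exact: measurable_funM.
- apply/measurable_EFinP/measurable_funTS; apply: measurable_funM => //.
  exact: measurable_funM.
move=> x; rewrite in_itv/= => /andP[tx _]; have x0 := lt_le_trans t0 tx.
rewrite lee_fin normrM ger0_norm ?powR_ge0// -mulrA ler_wpM2l ?powR_ge0//.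
rewrite (_ : \sum_(i < n) _ = rho (\sum_(i < n) c i * of_real (x `^ e i)) * x `^ (- a - 1)).
  by rewrite normrM mulrC ger0_norm ?powR_ge0// ler_wpM2l ?powR_ge0.
rewrite (rho_sum n c (fun i => x `^ e i)) mulr_suml; apply: eq_bigr => i _.
rewrite -mulrA -powRD; last by rewrite (gt_eqF x0) implybT.
by congr (_ * _ `^ _); ring.
Qed.

End pointwise.

(** * Hardy and triangle inequalities for the L_p norm *)

Section Lp_norm_theory.
Context {R : realType} {F : scalar_field}.
Local Notation K := (scalars R F).
Local Notation mu := (@lebesgue_measure R).
Variables (p : R) (p1 : 1 <= p).

Let p_neq0 : p != 0. Proof. by rewrite gt_eqF// (lt_le_trans _ p1). Qed.

Lemma Lp_normE (f : R -> K^o) : Lp_norm p f =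
  ((\int[mu]_(t in `[0%R, 1%R]) (scalar_abs (f t) `^ p)%:E) `^ p^-1)%E.
Proof.
rewrite /Lp_norm unlock /Lnorm; congr (_ `^ _)%E.
rewrite [RHS]integral_mkcond; apply: eq_integral => t _.
rewrite /= !patchE; case: ifPn => _ /=; last by rewrite normr0 powR0.
by rewrite ger0_norm// scalar_abs_ge0.
Qed.

(** The $p$-th root of [hardy]. The function [g] plays the role of $Cf$, and the factor $a$ is the
    one in the kernel: the norm of $C$ is at most $1/a$. *)
Lemma Lp_norm_hardy (f g : R -> K^o) (a : R) : 0 < a ->
  measurable_fun setT (scalar_abs \o f) -> measurable_fun setT (scalar_abs \o g) ->
  (forall t, 0 < t -> t <= 1 -> ((scalar_abs (g t))%:E <=
    \int[mu]_(x in `[t, 1%R]) (t `^ a * x `^ (- a - 1) * scalar_abs (f x))%:E)%E) ->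
  (Lp_norm p (fun t => of_real a * g t)%R <= Lp_norm p f)%E.
Proof.
move=> a0 mf mg gf; rewrite !Lp_normE.
have mpow r : measurable_fun [set: R] (fun x => x `^ r) by exact: measurable_powR.
apply: gt0_ler_poweR; first by rewrite invr_ge0 (le_trans _ p1).
- rewrite in_itv/= leey andbT integral_ge0// => t _.
  by rewrite lee_fin powR_ge0.
- rewrite in_itv/= leey andbT integral_ge0// => t _.
  by rewrite lee_fin powR_ge0.
under eq_integral do rewrite scalar_absM scalar_abs_of_real gtr0_norm//.
apply: (@hardy R p a p1 a0 (scalar_abs \o g) (scalar_abs \o f)) => //=.
- by move=> t; exact: scalar_abs_ge0.
- by move=> t; exact: scalar_abs_ge0.
move=> t t0 t1; rewrite EFinM (le_trans (lee_wpmul2l _ (gf t t0 t1))) ?lee_fin ?(ltW a0)//.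
rewrite -ge0_integralZl//=; last 3 first.
- apply/measurable_EFinP/measurable_funTS; apply: measurable_funM => //.
  exact: measurable_funM.
- by move=> x _; rewrite lee_fin !mulr_ge0 ?powR_ge0 ?scalar_abs_ge0.
- by rewrite lee_fin ltW.
rewrite le_eqVlt; apply/orP; left; apply/eqP; apply: eq_integral => x _ /=.
by rewrite -EFinM; congr (_%:E); rewrite !mulrA.
Qed.

(** Minkowski's inequality for bare functions, because the three functions will come from spans with
    different exponent sequences. *)
Lemma Lp_norm_triangle (f g h : R -> K^o) :
  measurable_fun setT (scalar_abs \o f) -> measurable_fun setT (scalar_abs \o g) ->
  measurable_fun setT (scalar_abs \o h) ->
  (forall t, h t = f t + g t) ->
  (Lp_norm p h <= Lp_norm p f + Lp_norm p g)%E.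
Proof.
move=> mf mg mh hfg.
have mr (u : R -> K^o) : measurable_fun setT (scalar_abs \o u) ->
    measurable_fun setT ((scalar_abs \o u) \_ `[0, 1]).
  move=> mu_; apply/(measurable_restrict _ _ _).1 => //; rewrite setTI.
  exact: measurable_funTS.
apply: (le_trans _ (@minkowski_EFin _ _ _ mu _ _ _ (mr _ mf) (mr _ mg) p1)).
apply: Lnorm_le => //; [exact: mr|by apply: measurable_funD; exact: mr|].
move=> t /=; rewrite !patchE; case: ifPn => _; last by rewrite addr0 lexx.
by rewrite scalar_abs_ge0/= hfg scalar_absD.
Qed.

End Lp_norm_theory.

(** * Polynomials as coefficient sequences *)

Section lincomb.
Context {K : nzRingType} {V : lmodType K}.
Implicit Types (G : nat -> V) (q : {poly K}).

(** A polynomial serves only as a finitely supported coefficient sequence, 'X^i being the $i$-th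
    basis vector. One vector space thus carries the norms of all exponent sequences. *)
Definition lincomb G q : V := \sum_(i < size q) q`_i *: G i.

Lemma lincomb_widen G q n : (size q <= n)%N ->
  lincomb G q = \sum_(i < n) q`_i *: G i.
Proof.
move=> qn; rewrite /lincomb (big_ord_widen n (fun i => q`_i *: G i) qn).
rewrite big_mkcond; apply: eq_bigr => i _; case: ltnP => // qi.
by rewrite nth_default// scale0r.
Qed.

Lemma lincomb_is_linear G : linear (lincomb G).
Proof.
move=> a q r; pose n := maxn (size (a *: q + r)) (maxn (size q) (size r)).
rewrite !(@lincomb_widen G _ n) ?leq_max ?leqnn ?orbT//.
rewrite scaler_sumr -big_split/=; apply: eq_bigr => i _.
by rewrite coefD coefZ scalerDl scalerA.
Qed.

HB.instance Definition _ G :=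
  GRing.isLinear.Build K {poly K} V *:%R (lincomb G) (lincomb_is_linear G).

Lemma lincombX G i : lincomb G 'X^i = G i.
Proof.
rewrite /lincomb size_polyXn big_ord_recr/= coefXn eqxx scale1r big1 ?add0r// => j _.
by rewrite coefXn ltn_eqF ?scale0r.
Qed.

Lemma eq_lincomb G G' q : (forall i, (i < size q)%N -> G i = G' i) ->
  lincomb G q = lincomb G' q.
Proof. by move=> GG; apply: eq_bigr => i _; rewrite GG. Qed.

End lincomb.

Lemma linear_lincomb (K : nzRingType) (V W : lmodType K) (f : {linear V -> W})
  (G : nat -> V) (q : {poly K}) : f (lincomb G q) = lincomb (f \o G) q.
Proof. by rewrite /lincomb linear_sum; apply: eq_bigr => i _; rewrite linearZ. Qed.

Lemma lincomb_Xn (K : nzRingType) (q : {poly K}) : lincomb (fun i => 'X^i) q = q.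
Proof. by rewrite /lincomb -poly_def coefK. Qed.

Section muntz_eval.
Context {R : realType} {F : scalar_field}.
Local Notation K := (scalars R F).

Fact monomial_span (e : R^nat) i : monomial F (e i) \in @muntz_span_pred R F e.
Proof.
apply/asboolP; exists i.+1, (fun j => if j == i then 1 else 0).
rewrite big_ord_recr/= eqxx scale1r big1 ?add0r// => j _.
by rewrite ltn_eqF ?scale0r.
Qed.

Definition muntz_eval (e : R^nat) : {poly K} -> muntz_span F e :=
  lincomb (fun i => MuntzSpan (monomial_span e i)).

Lemma muntz_span_fun_lincomb (e : R^nat) (G : nat -> muntz_span F e) (q : {poly K}) t :
  lincomb G q t = \sum_(i < size q) q`_i * G i t.
Proof.
rewrite /lincomb; elim/big_rec2: _ => // i x y _ <-.
by [].
Qed.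

Lemma muntz_evalE e q t : muntz_eval e q t = \sum_(i < size q) q`_i * of_real (t `^ e i).
Proof. exact: muntz_span_fun_lincomb. Qed.
End muntz_eval.

(** * Moving one exponent *)

Section shift.
Context {R : realType} {F : scalar_field}.
Local Notation K := (scalars R F).
Implicit Types (e : R^nat) (q : {poly K}).

Definition set_exp e k (b : R) : R^nat := fun i => if i == k then b else e i.

(* Partial fraction decomposition of (z + e k)/((z + b)(z + e i)), the Laplace
   transform of the image of t^(e i). *)
Definition shift_exp_basis e k (b : R) (i : nat) : {poly K} :=
  if i == k then 'X^k
  else of_real ((e k - e i) / (b - e i)) *: 'X^i
     + of_real ((b - e k) / (b - e i)) *: 'X^k.

Definition shift_exp e k b : {poly K} -> {poly K} := lincomb (shift_exp_basis e k b).

Lemma muntz_evalX e i t : muntz_eval e ('X^i : {poly K}) t = of_real (t `^ e i).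
Proof. by rewrite /muntz_eval lincombX. Qed.

Lemma muntz_evalD e q r t : muntz_eval e (q + r) t = muntz_eval e q t + muntz_eval e r t.
Proof. by rewrite /muntz_eval raddfD. Qed.

Lemma muntz_evalB e q r t : muntz_eval e (q - r) t = muntz_eval e q t - muntz_eval e r t.
Proof. by rewrite /muntz_eval raddfB. Qed.

Lemma muntz_evalZ e c q t : muntz_eval e (c *: q) t = c * muntz_eval e q t.
Proof. by rewrite /muntz_eval linearZ. Qed.

Lemma of_real1 : of_real 1 = 1 :> K. Proof. by case: F. Qed.

Lemma of_realB (x y : R) : of_real (x - y) = of_real x - of_real y :> K.
Proof. by apply: (addIr (of_real y)); rewrite -of_realD !subrK. Qed.

Lemma of_realN (x : R) : of_real (- x) = - of_real x :> K.
Proof. by rewrite -[- x]sub0r of_realB of_real0 sub0r. Qed.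

(** This identifies [shift_exp] with $I-(b-e_k)C$, where $C$ has exponent $b$ and
    $Ct^{e_i}=(t^{e_i}-t^b)/(b-e_i)$. *)
Lemma muntz_eval_shift e k b q t : (forall i, i != k -> e i != b) ->
  muntz_eval (set_exp e k b) (shift_exp e k b q) t = muntz_eval e q t -
  of_real (b - e k) *
  \sum_(i < size q) q`_i * of_real ((t `^ e i - t `^ b) / (b - e i)).
Proof.
move=> eb; rewrite [muntz_eval e q t]muntz_evalE /muntz_eval /shift_exp linear_lincomb muntz_span_fun_lincomb.
rewrite mulr_sumr -sumrB; apply: eq_bigr => i _.
rewrite mulrCA -mulrBr; congr (_ * _).
rewrite -of_realM -of_realB /= -/(muntz_eval _ _) /shift_exp_basis.
have [ik|ik] := eqVneq (i : nat) k.
  rewrite muntz_evalX /set_exp eqxx ik; congr of_real.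
  (* If $b=e_k$ the quotient has denominator 0, but the factor $b-e_k$ removes it. *)
  have [->|bk] := eqVneq b (e k); first by rewrite subrr mul0r subr0.
  by rewrite mulrCA divff ?subr_eq0// mulr1 opprB subrKC.
rewrite muntz_evalD !muntz_evalZ !muntz_evalX -!of_realM -of_realD /set_exp eqxx (negbTE ik); congr of_real.
have := eb _ ik; rewrite eq_sym -subr_eq0 => bi.
by field.
Qed.

(** The Laplace multipliers $(z+e_k)/(z+b)$ and $(z+b)/(z+e_k)$ are inverse to each other. On 'X^i
    with $i\ne k$, the coefficients of 'X^i multiply to 1 and those of 'X^k cancel. *)
Lemma shift_expK e k b :
  (forall i, i != k -> e i != b) -> (forall i, i != k -> e i != e k) ->
  cancel (shift_exp e k b) (shift_exp (set_exp e k b) k (e k)).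
Proof.
move=> eb ek q; rewrite {2}/shift_exp /shift_exp linear_lincomb -[RHS]lincomb_Xn.
apply: eq_lincomb => i _ /=; rewrite {2}/shift_exp_basis.
have mvX j : lincomb (shift_exp_basis (set_exp e k b) k (e k)) 'X^j =
    shift_exp_basis (set_exp e k b) k (e k) j by rewrite lincombX.
have [->|ik] := eqVneq i k; first by rewrite mvX /shift_exp_basis eqxx.
rewrite linearD !linearZ /= !mvX /shift_exp_basis eqxx (negbTE ik) /set_exp eqxx (negbTE ik).
rewrite scalerDr !scalerA -addrA -scalerDl -!of_realM -of_realD.
have := eb _ ik; rewrite eq_sym -subr_eq0 => bi.
have := ek _ ik; rewrite eq_sym -subr_eq0 => ki.
rewrite (_ : _ * _ = 1 :> R); last by field; rewrite bi ki.
rewrite (_ : _ + _ = 0 :> R); last by field; rewrite bi ki.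
by rewrite of_real0 scale0r addr0 of_real1 scale1r.
Qed.

Lemma size_shift_exp e k b q n : (k < n)%N -> (size q <= n)%N ->
  (size (shift_exp e k b q) <= n)%N.
Proof.
move=> kn qn; apply: (leq_trans (size_sum _ _ _)); apply/bigmax_leqP => i _.
have iN : (i < n)%N by exact: leq_trans qn.
have sX (c : K) j : (j < n)%N -> (size (c *: 'X^j : {poly K}) <= n)%N.
  by move=> jn; rewrite (leq_trans (size_scale_leq _ _))// size_polyXn.
rewrite (leq_trans (size_scale_leq _ _))// /shift_exp_basis; case: eqP => _.
  by rewrite size_polyXn.
by rewrite (leq_trans (size_polyD _ _))// geq_max !sX.
Qed.

Variables (p : R) (p1 : 1 <= p).

Definition muntz_norm e q : R := fine (Lp_norm p (muntz_eval e q)).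

(** Here [h] is $-(b-e_k)C$ applied to the function of [q], and Hardy's inequality bounds $C$ by
    $1/b$. It is kept as a separate element because it lies in the span of $t^b$ and all the
    $t^{e_i}$. *)
Lemma shift_exp_diff e k b q : (forall n, 0 < e n) -> 0 < b ->
  (forall i, i != k -> e i != b) ->
  exists (s : R^nat) (h : muntz_span F s), [/\ (forall n, 0 < s n),
    forall t, muntz_eval (set_exp e k b) (shift_exp e k b q) t = muntz_eval e q t + h t &
    fine (Lp_norm p h) <= `|b - e k| / b * muntz_norm e q].
Proof.
move=> e0 b0 eb.
(* The exponent $b$ takes index 0 and [e] moves up by one, so 'X^(i.+1) - 'X^0 stands for
   $t^{e_i}-t^b$. *)
pose s : R^nat := fun j => if j is i.+1 then e i else b.
have s0 n : 0 < s n by case: n.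
pose g : muntz_span F s :=
  muntz_eval s (lincomb (fun i => of_real (b - e i)^-1 *: ('X^(i.+1) - 'X^0)) q).
have gE t : g t = \sum_(i < size q) q`_i * of_real ((t `^ e i - t `^ b) / (b - e i)).
  rewrite /g /muntz_eval linear_lincomb muntz_span_fun_lincomb; apply: eq_bigr => i _.
  congr (_ * _); rewrite /= -/(muntz_eval _ _) muntz_evalZ muntz_evalB !muntz_evalX -of_realB -of_realM mulrC.
  by [].
exists s, (of_real (- (b - e k) / b) *: (of_real b *: g)); split => // [t|].
  rewrite (muntz_eval_shift _ _ eb) -gE; congr (_ + _).
  rewrite -[RHS]/(of_real (- (b - e k) / b) * (of_real b * g t)).
  rewrite mulrA -of_realM divfK ?gt_eqF//.
  by rewrite of_realN mulNr.
rewrite Lp_normZ// scalar_abs_of_real fineM//; last exact: Lp_norm_fin.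
rewrite normrM normrN normfV (ger0_norm (ltW b0)).
have [->|bk] := eqVneq b (e k); first by rewrite subrr normr0 !mul0r.
rewrite ler_wpM2l ?divr_ge0 ?(ltW b0)// /muntz_norm.
rewrite -lee_fin !fineK; [|exact: Lp_norm_fin..].
apply: (@Lp_norm_hardy R F p p1 (muntz_eval e q) g b b0).
- exact: measurable_abs_muntz_span.
- exact: measurable_abs_muntz_span.
move=> t t0 t1; rewrite gE.
have := @pointwise_bound R F (size q) (fun i => q`_i) e b t _ t0 t1.
under eq_integral do rewrite -muntz_evalE.
apply.
  move=> i _; have [->|] := eqVneq i k; first by rewrite eq_sym.
  exact: eb.
by apply: eq_measurable_fun (measurable_abs_muntz_span (muntz_eval e q)) => x _ /=; rewrite muntz_evalE.
Qed.

End shift.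

(** * Norm estimates for one move *)

Section muntz_norm_theory.
Context {R : realType} {F : scalar_field}.
Local Notation K := (scalars R F).
Variables (p : R) (p1 : 1 <= p).
Implicit Types (e : R^nat) (q : {poly K}).

Lemma muntz_normE e (e0 : forall n, 0 < e n) q :
  muntz_norm p e q = muntz_seminorm F p1 e0 (muntz_eval e q).
Proof. by []. Qed.

Lemma muntz_norm_ge0 e q : (forall n, 0 < e n) -> 0 <= muntz_norm p e q.
Proof. by move=> e0; rewrite (muntz_normE e0) seminorm_ge0. Qed.

Lemma muntz_normD e q r : (forall n, 0 < e n) ->
  muntz_norm p e (q + r) <= muntz_norm p e q + muntz_norm p e r.
Proof. by move=> e0; rewrite !(muntz_normE e0) /muntz_eval raddfD seminormD. Qed.

Lemma eq_muntz_norm e e' q : (forall i, (i < size q)%N -> e i = e' i) ->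
  muntz_norm p e q = muntz_norm p e' q.
Proof.
move=> ee; rewrite /muntz_norm; congr (fine (Lp_norm p _)); apply/funext => t.
by rewrite !muntz_evalE; apply: eq_bigr => i _; rewrite ee.
Qed.

Variables (e : R^nat) (k : nat) (b : R).
Hypotheses (e0 : forall n, 0 < e n) (b0 : 0 < b).
Hypothesis eb : forall i, i != k -> e i != b.

Lemma set_exp_gt0 n : 0 < set_exp e k b n.
Proof. by rewrite /set_exp; case: ifP. Qed.

Lemma muntz_norm_shift q :
  muntz_norm p (set_exp e k b) (shift_exp e k b q) <=
  (1 + `|b - e k| / b) * muntz_norm p e q.
Proof.
have [s [h [s0 hE hle]]] := shift_exp_diff p1 q e0 b0 eb.
rewrite mulrDl mul1r (le_trans _ (lerD (lexx _) hle))//.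
rewrite /muntz_norm -lee_fin EFinD !fineK; try exact: Lp_norm_fin.
  by apply: Lp_norm_triangle hE => //; exact: measurable_abs_muntz_span.
by apply: Lp_norm_fin => //; exact: set_exp_gt0.
Qed.

(** A polynomial of size at most $k$ does not involve the exponent of index $k$, so it is the same
    function before and after the move. The difference is then the correction term alone, which is
    what makes the infinite product converge. *)
Lemma muntz_norm_shift_sub q : (size q <= k)%N ->
  muntz_norm p (set_exp e k b) (shift_exp e k b q - q) <= `|b - e k| / b * muntz_norm p e q.
Proof.
move=> qk; have [s [h [s0 hE]]] := shift_exp_diff p1 q e0 b0 eb.
apply: le_trans; rewrite /muntz_norm le_eqVlt; apply/orP; left; apply/eqP.
congr (fine (Lp_norm p _)); apply/funext => t.
rewrite muntz_evalB hE (_ : muntz_eval (set_exp e k b) q t = muntz_eval e q t) ?[_ + h t]addrC ?addrK//.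
rewrite !muntz_evalE; apply: eq_bigr => i _; rewrite /set_exp ltn_eqF//.
exact: leq_trans qk.
Qed.

End muntz_norm_theory.

(** * Finite products of moves *)

Section chain.
Context {R : realType} {F : scalar_field}.
Local Notation K := (scalars R F).
Variables (p : R) (p1 : 1 <= p) (l u : R^nat).
Hypotheses (l_gt0 : forall n, 0 < l n).
Hypotheses (l_incr : increasing_seq l) (u_incr : increasing_seq u).
Hypothesis lu : forall n, l n <= u n.
Implicit Types q : {poly K}.

(** Bounds the correction in both directions: moving [l n] to [u n] costs $(u_n-l_n)/u_n\le s_n$,
    and moving back costs exactly $s_n$. *)
Let s : R^nat := fun n => (u n - l n) / l n.
Hypothesis s_cvg : cvgn (series s).

Definition mix k : R^nat := fun i => if (i < k)%N then l i else u i.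

Let u_gt0 n : 0 < u n. Proof. exact: lt_le_trans (lu n). Qed.

Lemma mix_gt0 k n : 0 < mix k n.
Proof. by rewrite /mix; case: ifP. Qed.

Let ltl i j : (i < j)%N -> l i < l j.
Proof. by move=> ij; rewrite ltNge [_ <= _](l_incr j i) -ltnNge. Qed.

Let ltu i j : (i < j)%N -> u i < u j.
Proof. by move=> ij; rewrite ltNge [_ <= _](u_incr j i) -ltnNge. Qed.

(** The reason for the mixed sequences: $l_i<l_k\le b$ for $i<k$ and $b\le u_k<u_i$ for $i>k$. The
    exponent moving between $l_k$ and $u_k$ thus meets no other one, although $u_k$ might exceed
    $l_{k+1}$. *)
Lemma mix_neq k b : l k <= b <= u k -> forall i, i != k ->
  mix k i != b /\ mix k.+1 i != b.
Proof.
move=> /andP[lb bu] i; rewrite neq_ltn /mix => /orP[ik|ki].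
  rewrite ik leqW// lt_eqF// (lt_le_trans (ltl ik) lb).
  by [].
by rewrite ltnNge ltnW//= ltnNge ki/= gt_eqF// (le_lt_trans bu (ltu ki)).
Qed.

Lemma set_exp_mixS k : set_exp (mix k.+1) k (u k) = mix k.
Proof.
apply/funext => i; rewrite /set_exp /mix ltnS; have [->|ik] := eqVneq i k.
  by rewrite ltnn.
by rewrite ltn_neqAle ik.
Qed.

Lemma set_exp_mix k : set_exp (mix k) k (l k) = mix k.+1.
Proof.
apply/funext => i; rewrite /set_exp /mix ltnS; have [->|ik] := eqVneq i k.
  by rewrite leqnn.
by rewrite ltn_neqAle ik.
Qed.

(** Leads from [mix k] to [mix 0], which is [u], moving the highest index first. The additional
    factor of [forward k.+1] therefore acts directly on the argument, before [forward k]. *)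
Fixpoint forward k : {poly K} -> {poly K} :=
  if k is k'.+1 then forward k' \o shift_exp (mix k'.+1) k' (u k') else id.

Fixpoint backward k : {poly K} -> {poly K} :=
  if k is k'.+1 then shift_exp (mix k') k' (l k') \o backward k' else id.

Lemma forward_is_linear k : linear (forward k).
Proof.
elim: k => [//|k IH] a q r /=; rewrite -IH /shift_exp linearP.
by [].
Qed.

HB.instance Definition _ k :=
  GRing.isLinear.Build K {poly K} {poly K} *:%R (forward k) (forward_is_linear k).

Let lk k : l k <= l k <= u k. Proof. by rewrite lexx lu. Qed.
Let uk k : l k <= u k <= u k. Proof. by rewrite lexx lu. Qed.

Lemma mixSkk k : mix k.+1 k = l k. Proof. by rewrite /mix ltnSn. Qed.
Lemma mixkk k : mix k k = u k. Proof. by rewrite /mix ltnn. Qed.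

Lemma forwardK k : cancel (forward k) (backward k).
Proof.
elim: k => [//|k IH] q /=.
have := @shift_expK R F (mix k.+1) k (u k); rewrite set_exp_mixS mixSkk IH => mK.
by rewrite mK// => i ik; [case: (mix_neq (uk k) ik)|case: (mix_neq (lk k) ik)].
Qed.

Lemma backwardK k : cancel (backward k) (forward k).
Proof.
elim: k => [//|k IH] q /=.
have := @shift_expK R F (mix k) k (l k); rewrite set_exp_mix mixkk => mK.
by rewrite mK ?IH// => i ik; [case: (mix_neq (lk k) ik)|case: (mix_neq (uk k) ik)].
Qed.

Lemma size_backward k q n : (k <= n)%N -> (size q <= n)%N -> (size (backward k q) <= n)%N.
Proof.
by move=> + qn; elim: k => [//|k IH] kn /=; apply: size_shift_exp => //; exact/IH/ltnW.
Qed.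

Let s_ge0 n : 0 <= s n. Proof. by rewrite divr_ge0 ?subr_ge0// ltW. Qed.

Let step_u k : `|u k - mix k.+1 k| / u k <= s k.
Proof.
rewrite mixSkk ger0_norm ?subr_ge0// ler_wpM2l ?subr_ge0//.
by rewrite lef_pV2 ?posrE.
Qed.

Let step_l k : `|l k - mix k k| / l k = s k.
Proof. by rewrite mixkk distrC ger0_norm// subr_ge0. Qed.

(** By $1+x\le e^x$ it bounds all the partial products of the $1+s_i$, hence all finite products of
    moves, in either direction, uniformly in $k$. *)
Let C := expR (limn (series s)).

Let prod_le k : \prod_(i < k) (1 + s i) <= C.
Proof.
apply: (@le_trans _ _ (expR (series s k))).
  rewrite seriesEord expR_sum; apply: ler_prod => i _.
  by rewrite addr_ge0//= expR_ge1Dx.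
rewrite ler_expR; apply: nondecreasing_cvgn_le => //.
exact: nondecreasing_series.
Qed.

Let muntz_norm_forward0 k q :
  muntz_norm p u (forward k q) <=
  (\prod_(i < k) (1 + s i)) * muntz_norm p (mix k) q.
Proof.
elim: k q => [|k IH] q /=.
  by rewrite big_ord0 mul1r le_eqVlt; apply/orP; left; apply/eqP/eq_muntz_norm => i _.
rewrite (le_trans (IH _))// big_ord_recr/= -mulrA ler_wpM2l//.
  by apply: prodr_ge0 => i _; rewrite addr_ge0.
rewrite -{1}(set_exp_mixS k).
rewrite (le_trans (muntz_norm_shift p1 (mix_gt0 k.+1) (u_gt0 k) _ q))//.
  by move=> i /(mix_neq (uk k))[].
by rewrite ler_wpM2r ?(muntz_norm_ge0 p1)// ?lerD2l//; exact: mix_gt0.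
Qed.

Lemma muntz_norm_forward k q : muntz_norm p u (forward k q) <= C * muntz_norm p (mix k) q.
Proof.
rewrite (le_trans (muntz_norm_forward0 _ _))// ler_wpM2r// (muntz_norm_ge0 p1)//.
exact: mix_gt0.
Qed.

Lemma muntz_norm_backward k q :
  muntz_norm p (mix k) (backward k q) <= C * muntz_norm p u q.
Proof.
apply: (@le_trans _ _ ((\prod_(i < k) (1 + s i)) * muntz_norm p u q)); last first.
  by rewrite ler_wpM2r// (muntz_norm_ge0 p1).
elim: k => [|k IH] /=.
  by rewrite big_ord0 mul1r le_eqVlt; apply/orP; left; apply/eqP/eq_muntz_norm => i _.
rewrite -{1}(set_exp_mix k).
rewrite (le_trans (muntz_norm_shift p1 (mix_gt0 k) (l_gt0 k) _ _))//.
  by move=> i /(mix_neq (lk k))[].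
by rewrite step_l big_ord_recr/= mulrAC mulrC ler_wpM2r// addr_ge0.
Qed.

Lemma muntz_norm_mix k q : (size q <= k)%N -> muntz_norm p (mix k) q = muntz_norm p l q.
Proof. by move=> qk; apply: eq_muntz_norm => i iq; rewrite /mix (leq_trans iq qk). Qed.

(** Telescoping from $m$ to $n$: the step at $i$ contributes at most $C s_i$ times the norm of [q].
    With [s] summable, the images of a fixed polynomial form a Cauchy sequence. *)
Lemma muntz_norm_forward_tail m n q : (size q <= m)%N -> (m <= n)%N ->
  muntz_norm p u (forward n q - forward m q) <= C * (series s n - series s m) * muntz_norm p l q.
Proof.
move=> qm /subnK <-; elim: (n - m)%N => [|j IH].
  rewrite add0n !subrr mulr0 mul0r -(@raddf0 _ _ (forward 0)).
  by rewrite (muntz_normE p1 u_gt0) /muntz_eval !raddf0 seminorm0.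
rewrite addSn; set i := (j + m)%N.
have qi : (size q <= i)%N by rewrite (leq_trans qm)// leq_addl.
rewrite -(subrK (forward i q) (forward _ _)) -addrA (le_trans (muntz_normD p1 _ _ u_gt0))//.
rewrite seriesSr (addrC _ (s i)) -addrA mulrDr mulrDl lerD//=.
(* The increment is [forward i] of the change made in [q] by the move at [i]; the outer map costs
   $C$ and [muntz_norm_shift_sub] gives $s_i$. *)
rewrite -raddfB/= (le_trans (muntz_norm_forward _ _))// -mulrA ler_wpM2l ?expR_ge0//.
rewrite -{1}(set_exp_mixS i).
rewrite (le_trans (muntz_norm_shift_sub p1 (mix_gt0 i.+1) (u_gt0 i) _ qi))//.
  by move=> v /(mix_neq (uk i))[].
by rewrite muntz_norm_mix ?leqW// ler_wpM2r ?(muntz_norm_ge0 p1).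
Qed.

End chain.

(** * Extension to the completions *)

Section relation.
Context {K : numFieldType} {X : lmodType K}.

(** The closure in $V\times W$ of the set of pairs $(Jx,J'x)$, which will be the graph of the
    isomorphism. Its symmetry in [V] and [W] lets the same lemmas serve for the inverse. *)
Definition joint_closure (V W : normedModType K) (J : X -> V) (J' : X -> W) v w :=
  forall e : K, 0 < e -> exists2 x, `|v - J x| < e & `|w - J' x| < e.

Lemma joint_closureC (V W : normedModType K) (J : X -> V) (J' : X -> W) v w :
  joint_closure J J' v w -> joint_closure J' J w v.
Proof. by move=> H e /H[x ? ?]; exists x. Qed.

Variables (V W : completeNormedModType K).
Variables (J : {linear X -> V}) (J' : {linear X -> W}) (C : K).
Hypotheses (C0 : 0 < C) (JJ' : forall x, `|J' x| <= C * `|J x|).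

Lemma joint_closure_linear a v w v' w' :
  joint_closure J J' v w -> joint_closure J J' v' w' ->
  joint_closure J J' (a *: v + v') (a *: w + w').
Proof.
move=> vw vw' e e0; have a1 : 0 < `|a| + 1 by rewrite ltr_wpDl.
have e1 : 0 < e / 2 / (`|a| + 1) by rewrite !divr_gt0.
have e2 : 0 < e / 2 by rewrite divr_gt0.
have [x xv xw] := vw _ e1; have [y yv yw] := vw' _ e2.
have H (U : normedModType K) (L : {linear X -> U}) (z z' : U) :
    `|z - L x| < e / 2 / (`|a| + 1) -> `|z' - L y| < e / 2 ->
    `|a *: z + z' - L (a *: x + y)| < e.
  move=> zx zy; rewrite linearP opprD addrACA -scalerBr.
  rewrite (le_lt_trans (ler_normD _ _))// [ltRHS]splitr ler_ltD// normrZ.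
  rewrite (@le_trans _ _ ((`|a| + 1) * `|z - L x|))//.
    by rewrite ler_wpM2r// lerDl.
  by rewrite mulrC -ler_pdivlMr// ltW.
by exists (a *: x + y); apply: H.
Qed.

(** The bound on $J'(x-y)$ by $J(x-y)$ passes to the limit. For $v=v'$ it shows that the relation is
    single-valued, and in general it gives continuity. *)
Lemma joint_closure_lipschitz v w v' w' :
  joint_closure J J' v w -> joint_closure J J' v' w' -> `|w - w'| <= C * `|v - v'|.
Proof.
move=> vw vw'; apply/ler_addgt0Pr => e e0.
(* With all approximations within $d$, the total error is $2d$ in [W] plus $C\cdot 2d$ from [V],
   whence $d=e/(2+2C)$. *)
have C2 : 0 < 2 + C *+ 2 by rewrite addr_gt0// pmulrn_lgt0.
have d0 : 0 < e / (2 + C *+ 2) by rewrite divr_gt0.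
set d := e / _ in d0.
have [x xv xw] := vw _ d0; have [y yv yw] := vw' _ d0.
have Jxy : `|J (x - y)| <= `|v - v'| + d *+ 2.
  rewrite raddfB/= (le_trans (ler_distD v _ _))// (distrC (J x)).
  have H := le_trans (ler_distD v' v (J y)) (lerD (lexx _) (ltW yv)).
  by rewrite (le_trans (lerD (ltW xv) H))// mulr2n addrCA.
rewrite (le_trans (ler_distD (J' x) _ _))//.
rewrite (le_trans (lerD (ltW xw) (ler_distD (J' y) _ _)))//.
rewrite -raddfB/= (le_trans (lerD (lexx d) (lerD (JJ' (x - y)) (lexx _))))//.
rewrite (le_trans (lerD (lexx d) (lerD (ler_wpM2l (ltW C0) Jxy) (lexx _))))//.
rewrite (distrC (J' y)) (le_trans (lerD (lexx d) (lerD (lexx _) (ltW yw))))//.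
rewrite le_eqVlt; apply/orP; left; apply/eqP.
have <- : d * (2 + C *+ 2) = e by rewrite divfK// gt_eqF.
by ring.
Qed.

(** The images under [J'] of the $x$ with $Jx$ close to $v$ generate a filter, which is Cauchy by
    the bound; its limit in the complete space [W] is the required [w]. *)
Lemma joint_closure_total v :
  (forall e, 0 < e -> exists x, `|v - J x| < e) ->
  exists w, joint_closure J J' v w.
Proof.
move=> dJ.
(* The order of [K] need not be total, but positive elements are real and so comparable. *)
have minP (e e' : K) : 0 < e -> 0 < e' -> exists d, [/\ 0 < d, d <= e & d <= e'].
  move=> e0 e'0.
  have /orP[ee'|ee'] := real_leVge (gtr0_real e0) (gtr0_real e'0).
    by exists e.
  by exists e'.
pose G := filter_from [set e : K | 0 < e] (fun e => J' @` [set x | `|v - J x| < e]).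
have GF : ProperFilter G.
  apply: filter_from_proper => [|e e0]; last first.
    by have [x xe] := dJ e e0; exists (J' x); exists x.
  apply: filter_from_filter; first by exists 1 => /=.
  move=> e e' e0 e'0; have [d [d0 de de']] := minP _ _ e0 e'0.
  exists d => // _ [x xd <-]; split; exists x => //=; exact: lt_le_trans xd _.
have Gc : cauchy G.
  apply/cauchyP => e e0.
  have d0 : 0 < e / C / 2 by rewrite !divr_gt0.
  have [x xd] := dJ _ d0; exists (J' x); exists (e / C / 2) => //.
  move=> _ [y yd <-]; rewrite -ball_normE/= -raddfB (le_lt_trans (JJ' _))//.
  rewrite mulrC -ltr_pdivlMr// raddfB/= (le_lt_trans (ler_distD v _ _))//.
  by rewrite [ltRHS]splitr ltrD// distrC.
have /cvg_ex[w Gw] : cvg G by exact: cauchy_cvg.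
exists w => e e0.
have /Gw [d d0 dB] : nbhs w (ball w e) by exact: nbhsx_ballx.
have [f [f0 fd fe]] := minP _ _ d0 e0.
have [x xf] := dJ _ f0; exists x; first exact: lt_le_trans fe.
have /dB : (J' @` [set x | `|v - J x| < d]) (J' x).
  by exists x => //=; exact: lt_le_trans fd.
by rewrite -ball_normE.
Qed.

End relation.

(** Two dense images of one space with equivalent norms: the joint closure is total and
    single-valued in both directions, hence the graph of a linear bijection that is Lipschitz both
    ways. Neither [J] nor [J'] is assumed injective. *)
Lemma isomorphic_of_dense (K : numFieldType) (X : lmodType K)
  (V W : completeNormedModType K) (J : {linear X -> V}) (J' : {linear X -> W}) (C : K) :
  0 < C -> (forall x, `|J' x| <= C * `|J x|) -> (forall x, `|J x| <= C * `|J' x|) ->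
  (forall v e, 0 < e -> exists x, `|v - J x| < e) ->
  (forall w e, 0 < e -> exists x, `|w - J' x| < e) ->
  isomorphic V W.
Proof.
move=> C0 JJ' J'J dJ dJ'.
have [f fP] := choice (fun v => joint_closure_total C0 JJ' (dJ v)).
have [g gP'] := choice (fun w => joint_closure_total C0 J'J (dJ' w)).
have gP w := joint_closureC (gP' w).
have func v w w' : joint_closure J J' v w -> joint_closure J J' v w' -> w = w'.
  move=> vw vw'; apply/eqP; rewrite -subr_eq0 -normr_le0.
  by have := joint_closure_lipschitz C0 JJ' vw vw'; rewrite subrr normr0 mulr0.
have func' v v' w : joint_closure J J' v w -> joint_closure J J' v' w -> v = v'.
  move=> /joint_closureC vw /joint_closureC vw'; apply/eqP.
  rewrite -subr_eq0 -normr_le0.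
  by have := joint_closure_lipschitz C0 J'J vw vw'; rewrite subrr normr0 mulr0.
have lip_continuous (U U' : normedModType K) (h : U -> U') :
    (forall x y, `|h x - h y| <= C * `|x - y|) -> continuous h.
  move=> hlip x; apply/cvgrPdist_lt => e e0.
  have eC : 0 < e / C by rewrite divr_gt0.
  apply: filterS (nbhsx_ballx x _ eC) => y; rewrite -ball_normE/= => xy.
  by rewrite (le_lt_trans (hlip _ _))// mulrC -ltr_pdivlMr.
have f_linear : linear f.
  by move=> a v v'; exact: func (fP _) (joint_closure_linear a (fP v) (fP v')).
pose fl : {linear V -> W} := HB.pack f (GRing.isLinear.Build K V W *:%R f f_linear).
exists fl, g; split.
- by move=> v /=; exact: func' (gP _) (fP v).
- by move=> w /=; exact: func (fP _) (gP w).
- by apply: lip_continuous => x y; exact: joint_closure_lipschitz (fP x) (fP y).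
- by apply: lip_continuous => x y; exact: joint_closure_lipschitz (gP' x) (gP' y).
Qed.

Lemma muntz_eval_surj (R : realType) (F : scalar_field) (e : R^nat) (f : muntz_span F e) :
  exists q, muntz_eval e q = f.
Proof.
have /asboolP[n [c fE]] := muntz_span_funP f.
exists (\sum_(i < n) c i *: 'X^i); apply/val_inj/funext => t /=.
rewrite fE muntz_sumE /muntz_eval linear_sum.
elim/big_rec2: _ => // i x y _ <-; rewrite linearZ /= lincombX.
by [].
Qed.

(** * The limit operator between the Müntz spaces *)

Section isomorphism.
Local Open Scope quotient_scope.
Context {R : realType} {F : scalar_field}.
Local Notation K := (scalars R F).
Variables (p : R) (p1 : 1 <= p) (l u : R^nat).
Hypotheses (l_gt0 : forall n, 0 < l n) (u_gt0 : forall n, 0 < u n).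
Hypotheses (l_incr : increasing_seq l) (u_incr : increasing_seq u).
Hypothesis lu : forall n, l n <= u n.
Let s : R^nat := fun n => (u n - l n) / l n.
Hypothesis s_cvg : cvgn (series s).
Implicit Types q : {poly K}.

Let C := expR (limn (series s)).
Let C_gt0 : 0 < C. Proof. exact: expR_gt0. Qed.
Let tail n := limn (series s) - series s n.

Let series_le n : series s n <= limn (series s).
Proof.
apply: nondecreasing_cvgn_le => //; apply: nondecreasing_series => i _ _.
by rewrite divr_ge0 ?subr_ge0// ltW.
Qed.

Let tail_small (P e : R) : 0 <= P -> 0 < e ->
  exists n0, forall n, (n0 <= n)%N -> C * tail n * P < e.
Proof.
(* The factor $P+1$ replaces $P$, which may be 0, as a divisor. *)
move=> P0 e0; have P1 : 0 < C * (P + 1) by rewrite mulr_gt0// ltr_wpDl.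
have /cvgrPdist_lt/(_ _ (divr_gt0 e0 P1))[n0 _ H] : series s @ \oo --> limn (series s).
  exact: s_cvg.
exists n0 => n /H /=; rewrite ger0_norm ?subr_ge0// ltr_pdivlMr//.
apply: le_lt_trans; rewrite mulrAC (mulrC (tail n)) -/(tail n).
by rewrite ler_wpM2r ?subr_ge0// ler_wpM2l ?(ltW C_gt0)// lerDl.
Qed.

Let forward_tail m n q : (size q <= m)%N -> (m <= n)%N ->
  muntz_norm p u (forward l u n q - forward l u m q) <= C * tail m * muntz_norm p l q.
Proof.
move=> qm mn; rewrite (le_trans (muntz_norm_forward_tail p1 l_gt0 l_incr u_incr lu s_cvg qm mn))//.
rewrite ler_wpM2r ?(muntz_norm_ge0 p1)// ler_wpM2l ?expR_ge0// lerD2r.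
exact: series_le.
Qed.

Local Notation N := (muntz_seminorm F p1 u_gt0).

Let image_cauchy q : (fun n => muntz_eval u (forward l u n q)) \in cauchy_pred N.
Proof.
apply/asboolP => e e0.
have [n0 H] := tail_small (muntz_norm_ge0 p1 q l_gt0) e0.
have small m n : (maxn n0 (size q) <= m)%N -> (m <= n)%N ->
    N (muntz_eval u (forward l u n q) - muntz_eval u (forward l u m q)) < e.
  rewrite geq_max => /andP[m1 m2] mn; rewrite -raddfB.
  exact: le_lt_trans (forward_tail m2 mn) (H _ m1).
exists (maxn n0 (size q)) => m n m0 n0'.
have [mn|/ltnW nm] := leqP m n; last exact: small.
by rewrite seminormB; exact: small.
Qed.

(** The infinite product of the moves applied to [q]: the limit of the [forward l u n q], given in
    the completion as the class of that Cauchy sequence. *)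
Definition image q : muntz_space F p1 u_gt0 :=
  \pi_(completion N) (CauchySequence (image_cauchy q)).

Lemma image_is_linear : linear image.
Proof.
move=> a q r.
rewrite -[a *: image q]/(completion_scale a (\pi_(completion N) _)) completion_piZ.
rewrite -completion_piD; congr (\pi_(completion N) _).
by apply/val_inj/funext => n /=; rewrite /muntz_eval !linearP.
Qed.

HB.instance Definition _ :=
  GRing.isLinear.Build K {poly K} (muntz_space F p1 u_gt0) *:%R image image_is_linear.

Let embed q : muntz_space F p1 l_gt0 :=
  completion_embed (muntz_seminorm F p1 l_gt0) (muntz_eval l q).

Let embed_is_linear : linear embed.
Proof. by move=> a q r; rewrite /embed /muntz_eval !linearP. Qed.

HB.instance Definition _ :=
  GRing.isLinear.Build K {poly K} (muntz_space F p1 l_gt0) *:%R embed embed_is_linear.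

Let norm_embed q : `|embed q| = of_real (muntz_norm p l q).
Proof. exact: completion_embed_norm. Qed.

Let norm_image q : `|image q| = of_real (limit_seminorm (CauchySequence (image_cauchy q))).
Proof. exact: completion_norm_pi. Qed.

Let image_le q : `|image q| <= of_real C * `|embed q|.
Proof.
rewrite norm_image norm_embed -of_realM le_of_real.
apply: (@limit_seminorm_le _ _ _ _ _ _ (size q)) => n qn /=.
by rewrite -(muntz_norm_mix p l u qn); exact: muntz_norm_forward.
Qed.

(** As [q] is [backward] of [forward] at every $n$, the uniform bound on [backward] holds along the
    sequence and passes to the limit. *)
Let embed_le q : `|embed q| <= of_real C * `|image q|.
Proof.
rewrite norm_image norm_embed -of_realM le_of_real mulrC -ler_pdivrMr//.
apply: limr_ge; first exact: cauchy_seminorm_cvg.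
exists (size q) => // n /= qn; rewrite ler_pdivrMr// mulrC.
rewrite -(muntz_norm_mix p l u qn) -{1}(forwardK l_incr u_incr lu n q).
exact: muntz_norm_backward.
Qed.

Let embed_dense v (e : K) : 0 < e -> exists q, `|v - embed q| < e.
Proof.
move=> /of_real_pos[d d0 ->].
have [f fv] := completion_approx v (divr_gt0 d0 (ltr0Sn R 1)).
have [q qf] := muntz_eval_surj f; exists q; rewrite /embed qf (le_lt_trans fv)//.
by rewrite lt_of_real ltr_pdivrMr// ltr_pMr// ltr1n.
Qed.

(** Near [w] there is the function of some polynomial [q] with exponents [u]. For large $n$,
    [forward] at $n$ takes [backward l u n q] to [q] exactly, and the remaining factors change it by
    a small tail only. *)
Let image_dense w (e : K) : 0 < e -> exists q, `|w - image q| < e.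
Proof.
move=> /of_real_pos[d d0 ->].
have d2 : 0 < d / 2 by rewrite divr_gt0.
have [f fw] := completion_approx w d2.
have [q qf] := muntz_eval_surj f.
(* For every $n\ge$ [size q], $C$ times the [u]-norm of [q] bounds the [l]-norm of
   [backward l u n q]; this lets [n0] be fixed before $n$. *)
have [n0 H] := tail_small (mulr_ge0 (ltW C_gt0) (muntz_norm_ge0 p1 q u_gt0)) d2.
pose n := maxn n0 (size q).
have nn0 : (n0 <= n)%N by rewrite leq_maxl.
have nq : (size q <= n)%N by rewrite leq_maxr.
exists (backward l u n q); rewrite (splitr d) of_realD.
rewrite (le_lt_trans (ler_distD (completion_embed N f) _ _))// ler_ltD//.
rewrite distrC; set r := backward l u n q.
have sr : (size r <= n)%N by exact: size_backward.
suff : limit_seminorm (CauchySequence (image_cauchy r) -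
    CauchySequence (const_cauchy N f)) < d / 2.
  rewrite -(@lt_of_real R F) -completion_norm_pi completion_piD completion_piN.
  by [].
apply: le_lt_trans (H _ nn0).
apply: (@limit_seminorm_le _ _ _ _ _ _ n) => k nk /=.
rewrite -[leLHS]/(N (muntz_eval u (forward l u k r) - f)).
rewrite -qf -{1}(backwardK l_incr u_incr lu n q) -/r -raddfB.
apply: (le_trans (forward_tail sr nk)); rewrite ler_wpM2l ?mulr_ge0 ?subr_ge0//.
  exact: ltW.
by rewrite -(muntz_norm_mix p l u sr) muntz_norm_backward.
Qed.

Lemma muntz_space_isomorphic :
  isomorphic (muntz_space F p1 l_gt0) (muntz_space F p1 u_gt0).
Proof.
apply: (@isomorphic_of_dense _ _ _ _ embed image (of_real C)) => //.
by rewrite -(@of_real0 R F) (@lt_of_real R F).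
Qed.

End isomorphism.

Unset Implicit Arguments.
Set Strict Implicit.
Theorem theorem5 (R : realType) (F : scalar_field) (p : R) (p1 : 1 <= p)
  (lambda upsilon : R^nat)
  (lambda_gt0 : forall n, 0 < lambda n) (upsilon_gt0 : forall n, 0 < upsilon n)
  (lambda_incr : increasing_seq lambda) (upsilon_incr : increasing_seq upsilon)
  (lambda_gap : gap_condition lambda) (upsilon_gap : gap_condition upsilon)
  (lambda_muntz : muntz_condition lambda)
  (upsilon_muntz : muntz_condition upsilon)
  (lambda_le_upsilon : forall n, lambda n <= upsilon n)
  (delta : R)
  (delta_sup :
    ereal_sup (range (fun n => (upsilon n - lambda n)%:E)) = delta%:E)
  (delta_small : delta < (8 * limn (series (fun n => (lambda n)^-1)))^-1) :
  isomorphic (muntz_space F p1 lambda_gt0) (muntz_space F p1 upsilon_gt0).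
Proof.
apply: muntz_space_isomorphic => //.
(* Since $\upsilon_n-\lambda_n\le\delta$, the relative shifts are dominated by $\delta$ times the
   terms of the convergent Müntz series. *)
apply: (@series_le_cvg _ _ (fun n => delta * (lambda n)^-1)).
- by move=> n; rewrite divr_ge0 ?subr_ge0// ltW.
- move=> n; rewrite mulr_ge0 ?invr_ge0 ?(ltW (lambda_gt0 n))//.
  rewrite -lee_fin -delta_sup; apply: (@le_trans _ _ (upsilon n - lambda n)%:E).
    by rewrite lee_fin subr_ge0.
  by apply: ereal_sup_ubound; exists n.
- move=> n; rewrite ler_wpM2r ?invr_ge0 ?(ltW (lambda_gt0 n))//.
  by rewrite -lee_fin -delta_sup; apply: ereal_sup_ubound; exists n.
- exact: is_cvg_seriesZ.
Qed.
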